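(* A countable group containing an infinite normal amenable subgroup is not measure equivalent to any group in $\mathcal C_{\mathrm{reg}}$.
   Context: Bounded cohomology: for a countable discrete group $\Gamma$ and a unitary representation $\pi$ of $\Gamma$ on a separable Hilbert space $\mathcal H$, $\mathrm H^n_{\mathrm b}(\Gamma,\pi)$ is the $n$-th cohomology of the complex $0\to\ell^\infty(\Gamma,\mathcal H)^\Gamma\to\ell^\infty(\Gamma^2,\mathcal H)^\Gamma\to\cdots$ of bounded functions invariant under $(\gamma f)(\gamma_0,\dots,\gamma_n)=\pi(\gamma)f(\gamma^{-1}\gamma_0,\dots,\gamma^{-1}\gamma_n)$, with the usual homogeneous coboundary maps ($\ell^\infty(\Gamma^{n+1},\mathcal H)^\Gamma$ in degree $n$). $\mathcal C_{\mathrm{reg}}$ is the class of countable groups $\Gamma$ with $\mathrm H^2_{\mathrm b}(\Gamma,\ell^2(\Gamma))\neq 0$, where $\ell^2(\Gamma)$ carries the regular representation. Two countable groups $\Gamma,\Lambda$ are measure equivalent if there is a standard (possibly infinite) measure space $(\Sigma,m)$ with commuting measure-preserving $\Gamma$- and $\Lambda$-actions such that each one of the two actions admits a finite measure fundamental domain. *)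

(* Defs.v *)
From HB Require Import structures.
From mathcomp Require Import all_boot all_order all_algebra.
From mathcomp Require Import all_classical all_reals all_analysis.
From mathcomp Require Import complex.
From mathcomp Require Import ring zify.
Set Implicit Arguments.
Unset Strict Implicit.
Unset Printing Implicit Defensive.
Import Order.TTheory GRing.Theory Num.Theory.
Import numFieldNormedType.Exports.
Local Open Scope classical_set_scope.
Local Open Scope complex_scope.
Local Open Scope ring_scope.

Section SquareSummable.
Variables (R : realType) (G : choiceType).
Implicit Types f g : G -> R[i].

(* The modulus as an element of R: the norm of R[i] takes values in R[i]. *)
Definition cabs (z : R[i]) : R := complex.Re `|z|.

Lemma cabsE z : (cabs z)%:C = `|z|.
Proof. by apply: RRe_real; exact: normr_real. Qed.

Lemma cabs_ge0 z : 0 <= cabs z.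
Proof. rewrite -lecR cabsE; exact: normr_ge0. Qed.

Lemma cabsD y z : cabs (y + z) <= cabs y + cabs z.
Proof. by rewrite -lecR rmorphD /= !cabsE ler_normD. Qed.

Lemma cabsM y z : cabs (y * z) = cabs y * cabs z.
Proof. by apply: (@complexI R); rewrite rmorphM /= !cabsE normrM. Qed.

Lemma esumZ_ge0 (c : R) (a : G -> R) : 0 <= c -> (forall x, 0 <= a x) ->
  (\esum_(x in [set: G]) (c * a x)%:E =
   c%:E * \esum_(x in [set: G]) (a x)%:E)%E.
Proof.
have le_esumZ (k : R) (b : G -> R) : 0 <= k -> (forall x, 0 <= b x) ->
    (\esum_(x in [set: G]) (k * b x)%:E <=
     k%:E * \esum_(x in [set: G]) (b x)%:E)%E.
  move=> k0 b0; apply: ge_ereal_sup => _ [A finA <-].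
  under eq_fsbigr do rewrite EFinM.
  rewrite -ge0_mule_fsumr; last by move=> x; rewrite lee_fin.
  by apply: lee_wpmul2l; [rewrite lee_fin | apply: esum_ge; exists A].
move=> c0 a0; apply/eqP; rewrite eq_le le_esumZ //=.
have [->|cn0] := eqVneq c 0.
  by rewrite mul0e; apply: esum_ge0 => x _; rewrite lee_fin mul0r.
have cp : 0 < c by rewrite lt_def cn0.
rewrite -lee_pdivlMl // (le_trans _ (le_esumZ c^-1 _ _ _)) //.
- by apply: le_esum => x _; rewrite lee_fin mulKf.
- by rewrite invr_ge0.
- by move=> x; exact: mulr_ge0.
Qed.

Definition sqsum f : \bar R := (\esum_(x in [set: G]) (cabs (f x) ^+ 2)%:E)%E.

Lemma sqsum_ge0 f : (0 <= sqsum f)%E.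
Proof. by apply: esum_ge0 => x _; rewrite lee_fin sqr_ge0. Qed.

Lemma sqsum0 : sqsum 0 = 0%E.
Proof. by apply: esum1 => x _; rewrite /cabs normr0 expr0n. Qed.

Lemma sqsumZ (c : R[i]) f : sqsum (c *: f) = ((cabs c ^+ 2)%:E * sqsum f)%E.
Proof.
rewrite -esumZ_ge0 ?sqr_ge0 //; last by move=> x; exact: sqr_ge0.
by apply: eq_esum => x _; rewrite fctE cabsM exprMn.
Qed.

(* The optimum t = ||g|| / ||f|| gives the triangle inequality. *)
Lemma sqsumD_le (t : R) f g : 0 < t ->
  (sqsum (f + g)%R <= (1 + t)%:E * sqsum f + (1 + t^-1)%:E * sqsum g)%E.
Proof.
move=> t0; have tge0 : 0 <= 1 + t by rewrite addr_ge0 // ltW.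
have ti0 : 0 <= 1 + t^-1 by rewrite addr_ge0 // invr_ge0 ltW.
rewrite -!esumZ_ge0 //; try by move=> x; exact: sqr_ge0.
rewrite -esumD; try by move=> x _; rewrite lee_fin mulr_ge0 // sqr_ge0.
apply: le_esum => x _; rewrite -EFinD lee_fin fctE.
apply: (@le_trans _ _ ((cabs (f x) + cabs (g x)) ^+ 2)).
  by rewrite ler_pXn2r ?nnegrE ?addr_ge0 ?cabs_ge0 ?cabsD.
rewrite -subr_ge0.
set a := cabs _; set b := cabs _.
have -> : (1 + t) * a ^+ 2 + (1 + t^-1) * b ^+ 2 - (a + b) ^+ 2 =
          t^-1 * (t * a - b) ^+ 2.
  by field; rewrite gt_eqF.
by rewrite mulr_ge0 ?sqr_ge0 // invr_ge0 ltW.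
Qed.

Definition l2_pred : {pred G -> R[i]} := fun f => (sqsum f < +oo)%E.

Lemma l2_submod_closed : submod_closed l2_pred.
Proof.
split=> [|c f g]; first by rewrite unfold_in /l2_pred sqsum0.
rewrite !unfold_in /l2_pred => fl gl.
apply: (le_lt_trans (sqsumD_le _ _ ltr01)).
rewrite sqsumZ; apply: lte_add_pinfty.
  by rewrite muleA -EFinM lte_mul_pinfty // lee_fin mulr_ge0 ?sqr_ge0 ?addr_ge0.
by rewrite lte_mul_pinfty // lee_fin invr1 addr_ge0.
Qed.

HB.instance Definition _ :=
  GRing.isSubmodClosed.Build R[i] (G -> R[i]) l2_pred l2_submod_closed.

Record l2 := L2 { l2_fun :> G -> R[i]; _ : l2_fun \in l2_pred }.
HB.instance Definition _ := [isSub for l2_fun].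
HB.instance Definition _ := [Choice of l2 by <:].
HB.instance Definition _ := [SubChoice_isSubLmodule of l2 by <:].

Lemma sqsum_fin (f : l2) : sqsum f = (fine (sqsum f))%:E.
Proof.
have fP : (sqsum f < +oo)%E := valP f.
by rewrite fineK // ge0_fin_numE ?sqsum_ge0.
Qed.

Definition l2norm (f : l2) : R := Num.sqrt (fine (sqsum f)).

Lemma sqr_l2norm (f : l2) : l2norm f ^+ 2 = fine (sqsum f).
Proof. by rewrite sqr_sqrtr // fine_ge0 ?sqsum_ge0. Qed.

Lemma sqsumE (f : l2) : sqsum f = (l2norm f ^+ 2)%:E.
Proof. by rewrite sqr_l2norm -sqsum_fin. Qed.

Lemma l2norm0_eq0 (f : l2) : l2norm f = 0 -> f = 0.
Proof.
move=> f0; apply: val_inj; apply/funext => x /=.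
have : (sqsum f <= 0)%E by rewrite sqsumE f0 expr0n.
move=> /(le_trans _) fx; suff : cabs (f x) ^+ 2 <= 0.
  rewrite real_exprn_even_le0 //= ?num_real // => /eqP c0.
  by apply: normr0_eq0; rewrite -cabsE c0.
rewrite -lee_fin; apply: fx; apply: esum_ge.
by exists [set x]; [split | rewrite fsbig_set1].
Qed.

Lemma ler_l2normD (f g : l2) : l2norm (f + g) <= l2norm f + l2norm g.
Proof.
have [/l2norm0_eq0 ->|f0] := eqVneq (l2norm f) 0.
  by rewrite add0r lerDr sqrtr_ge0.
have [/l2norm0_eq0 ->|g0] := eqVneq (l2norm g) 0.
  by rewrite addr0 lerDl sqrtr_ge0.
have fp : 0 < l2norm f by rewrite lt_def f0 sqrtr_ge0.
have gp : 0 < l2norm g by rewrite lt_def g0 sqrtr_ge0.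
have := sqsumD_le f g (divr_gt0 gp fp).
rewrite -[X in sqsum X]/(\val (f + g)) !sqsumE -!EFinM -EFinD lee_fin invf_div.
have -> : (1 + l2norm g / l2norm f) * l2norm f ^+ 2 +
          (1 + l2norm f / l2norm g) * l2norm g ^+ 2 =
          (l2norm f + l2norm g) ^+ 2 by field; rewrite f0 g0.
by rewrite ler_pXn2r // nnegrE ?addr_ge0 ?sqrtr_ge0.
Qed.

Lemma l2normZ c (f : l2) : l2norm (c *: f) = cabs c * l2norm f.
Proof.
rewrite /l2norm -[X in sqsum X]/(c *: \val f) sqsumZ sqsum_fin -EFinM /=.
by rewrite sqrtrM ?sqr_ge0 // sqrtr_sqr ger0_norm ?cabs_ge0.
Qed.

Let l2normC (f : l2) : R[i] := (l2norm f)%:C.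

Let ler_l2normCD (f g : l2) : l2normC (f + g) <= l2normC f + l2normC g.
Proof. by rewrite /l2normC -rmorphD /= lecR ler_l2normD. Qed.

Let l2normCZ (c : R[i]) (f : l2) : l2normC (c *: f) = `|c| * l2normC f.
Proof. by rewrite /l2normC l2normZ rmorphM /= cabsE. Qed.

Let l2normC0_eq0 (f : l2) : l2normC f = 0 -> f = 0.
Proof. by move=> f0; apply: l2norm0_eq0; exact: (@complexI R). Qed.

HB.instance Definition _ :=
  Lmodule_isNormed.Build R[i] l2 ler_l2normCD l2normCZ l2normC0_eq0.
End SquareSummable.

(* For a Hilbert space V these are the unitary representations of G on V: a
   linear isometric action is by bijections. *)
Record isometric_rep (R : realType) (G : groupType) (V : normedModType R[i]) :=
  IsometricRep {
    rep_fun :> G -> {linear V -> V};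
    rep_norm : forall g v, `|rep_fun g v| = `|v|;
    rep1 : forall v, rep_fun 1%g v = v;
    repM : forall g h v, rep_fun (g * h)%g v = rep_fun g (rep_fun h v)
  }.

Section RegularRepresentation.
Variables (R : realType) (G : groupType).

(* Left regular representation: (g f)(x) = f(g^-1 x). *)
Definition ltrans (g : G) (f : G -> R[i]) : G -> R[i] :=
  fun x => f (g^-1 * x)%g.

Lemma sqsum_ltrans g f : sqsum (ltrans g f) = sqsum f.
Proof.
rewrite /sqsum [RHS](@reindex_esum _ _ _ setT _ (fun x => g^-1 * x)%g) //.
rewrite setTT_bijective; exists (fun x => g * x)%g => x;
  by rewrite mulgA ?mulgV ?mulVg mul1g.
Qed.

Lemma ltrans_l2 g (f : l2 R G) : ltrans g f \in @l2_pred R G.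
Proof. by rewrite unfold_in /l2_pred sqsum_ltrans; exact: (valP f). Qed.

Definition regular (g : G) (f : l2 R G) : l2 R G := L2 (ltrans_l2 g f).

Lemma regular_linear g : linear (regular g).
Proof. by move=> c f h; apply: val_inj. Qed.

HB.instance Definition _ g :=
  GRing.isLinear.Build R[i] (l2 R G) (l2 R G) *:%R (regular g) (regular_linear g).

Lemma regular_norm g (f : l2 R G) : `|regular g f| = `|f|.
Proof. by congr ((Num.sqrt (fine _))%:C); exact: sqsum_ltrans. Qed.

Lemma regular1 (f : l2 R G) : regular 1%g f = f.
Proof.
by apply: val_inj; apply/funext => x; rewrite /= /ltrans invg1 mul1g.
Qed.

Lemma regularM g h (f : l2 R G) : regular (g * h)%g f = regular g (regular h f).
Proof.
by apply: val_inj; apply/funext => x; rewrite /= /ltrans invgM mulgA.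
Qed.

Definition regular_rep : isometric_rep G (l2 R G) :=
  @IsometricRep R G (l2 R G) (fun g => regular g)
    regular_norm regular1 regularM.
End RegularRepresentation.


Section BoundedCohomology.
Variables (R : realType) (G : groupType) (V : normedModType R[i]).
Variable pi : isometric_rep G V.

(* An (n+1)-tuple of elements of G is a function 'I_n.+1 -> G, so the type
   [cochain n] below is the space of invariant bounded functions on G^(n+1). *)
Section Degree.
Variable n : nat.
Implicit Types (f : ('I_n.+1 -> G) -> V).

Definition bounded_cochain f := exists M : R[i], forall x, `|f x| <= M.

Definition invariant_cochain f :=
  forall g x, pi g (f (fun i => g^-1 * x i)%g) = f x.

Definition cochain_pred : {pred ('I_n.+1 -> G) -> V} :=
  fun f => `[< bounded_cochain f /\ invariant_cochain f >].

Lemma cochain_zmod_closed : zmod_closed cochain_pred.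
Proof.
split=> [|f h /asboolP[[M fM] fi] /asboolP[[N hN] hi]]; apply/asboolP; split.
- by exists 0 => x; rewrite normr0.
- by move=> g x; rewrite raddf0.
- by exists (M + N) => x; rewrite (le_trans (ler_normB _ _)) // lerD.
- by move=> g x; rewrite -[RHS]/(f x - h x) -(fi g) -(hi g) -raddfB.
Qed.

HB.instance Definition _ :=
  GRing.isZmodClosed.Build (('I_n.+1 -> G) -> V) cochain_pred
    cochain_zmod_closed.

Record cochain := Cochain {
  cochain_fun :> ('I_n.+1 -> G) -> V;
  _ : cochain_fun \in cochain_pred
}.
HB.instance Definition _ := [isSub for cochain_fun].
HB.instance Definition _ := [Choice of cochain by <:].
HB.instance Definition _ := [SubChoice_isSubZmodule of cochain by <:].

Definition coboundary_fun f (x : 'I_n.+2 -> G) : V :=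
  \sum_(i < n.+2) (-1) ^+ i *: f (fun j => x (lift i j)).
End Degree.

Lemma coboundary_cochain n (f : cochain n) :
  coboundary_fun f \in @cochain_pred n.+1.
Proof.
case: f => f /= /asboolP[[M fM] fi]; apply/asboolP; split.
  exists (\sum_(i < n.+2) M) => x; rewrite (le_trans (ler_norm_sum _ _ _)) //.
  by apply: ler_sum => i _; rewrite normrZ normrX normrN1 expr1n mul1r.
move=> g x; rewrite raddf_sum; apply: eq_bigr => i _.
rewrite /= linearZZ; congr (_ *: _).
exact: (fi g (fun j => x (lift i j))).
Qed.

Definition coboundary n (f : cochain n) : cochain n.+1 :=
  Cochain (coboundary_cochain f).

Lemma coboundary_zmod_morphism n : zmod_morphism (@coboundary n).
Proof.
move=> f h; apply: val_inj; apply/funext => x /=.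
rewrite -[RHS]/(coboundary_fun f x - coboundary_fun h x) -sumrB.
by apply: eq_bigr => i _; rewrite -scalerBr.
Qed.

HB.instance Definition _ n :=
  GRing.isZmodMorphism.Build (cochain n) (cochain n.+1) (@coboundary n)
    (@coboundary_zmod_morphism n).

Lemma coboundary_coboundary n (f : cochain n) :
  coboundary (coboundary f) = 0.
Proof.
apply: val_inj; apply/funext => x /=; rewrite /coboundary_fun /=.
under eq_bigr do rewrite /coboundary_fun scaler_sumr.
rewrite pair_big /=.
under eq_bigr do rewrite scalerA -exprD.
rewrite (bigID (fun p : 'I_n.+3 * 'I_n.+2 => (p.1 <= p.2)%N)) /=.
pose h (p : 'I_n.+3 * 'I_n.+2) := (lift ord0 p.2, inord p.1 : 'I_n.+2).
pose k (p : 'I_n.+3 * 'I_n.+2) := (inord p.2 : 'I_n.+3, inord p.1.-1 : 'I_n.+2).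
rewrite [X in _ + X](reindex_onto h k) /=; last first.
  move=> [i j] /= ij; have li := ltn_ord i; have lj := ltn_ord j.
  rewrite /h /k /=; congr (_, _); apply: val_inj; rewrite /= /bump.
    by rewrite inordK; lia.
  by rewrite !inordK //; lia.
rewrite [X in _ + X](eq_bigl (fun p : 'I_n.+3 * 'I_n.+2 => (p.1 <= p.2)%N)); last first.
  move=> [i j] /=; have li := ltn_ord i; have lj := ltn_ord j.
  have [ij|ij] := leqP i j.
    rewrite inordK; last by lia.
    apply/andP; split; first by rewrite /bump; lia.
    by apply/eqP; congr (_, _); apply: val_inj; rewrite /= ?inordK /bump; lia.
  apply/negP => /andP[]; rewrite /bump /= => h1 /eqP [] h2 _.
  have := congr1 val h2; rewrite /= inordK; last by apply: leqW; exact: ltn_ord.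
  move=> /= ii; have := ltn_ord (inord i : (ordinal n.+2)); rewrite ii => i2.
  by move: h1; rewrite inordK //; lia.
rewrite -big_split /=; apply: big1 => -[i j] /= ij.
have li := ltn_ord i; have lj := ltn_ord j.
have -> : (fun j0 : 'I_n.+1 => x (lift (lift ord0 j) (lift (inord i) j0))) =
          (fun j0 : 'I_n.+1 => x (lift i (lift j j0))).
  apply/funext => l; congr x; apply: val_inj; rewrite /= inordK /bump; lia.
rewrite -scalerDl inordK /bump; last by lia.
have -> : ((0 <= j) + j + i = (i + j).+1)%N by lia.
by rewrite exprS mulN1r subrr scale0r.
Qed.

Definition cocycle_pred n : {pred cochain n} := fun f => coboundary f == 0.

Lemma cocycle_zmod_closed n : zmod_closed (@cocycle_pred n).
Proof.
split=> [|f h]; first by rewrite unfold_in /cocycle_pred raddf0.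
rewrite !unfold_in /cocycle_pred => /eqP f0 /eqP h0.
by rewrite raddfB /= f0 h0 subrr.
Qed.

HB.instance Definition _ n :=
  GRing.isZmodClosed.Build (cochain n) (@cocycle_pred n)
    (@cocycle_zmod_closed n).

Record cocycle n := Cocycle {
  cocycle_cochain :> cochain n;
  _ : cocycle_cochain \in @cocycle_pred n
}.
HB.instance Definition _ n := [isSub for @cocycle_cochain n].
HB.instance Definition _ n := [Choice of cocycle n by <:].
HB.instance Definition _ n := [SubChoice_isSubZmodule of cocycle n by <:].

(* The complex starts in degree 0, where the image of the previous differential
   is 0. *)
Definition exact_pred n : {pred cocycle n} :=
  match n with
  | 0 => fun z => z == 0
  | m.+1 => fun z => `[< exists f : cochain m, coboundary f = z >]
  end.

Lemma exact_zmod_closed n : zmod_closed (@exact_pred n).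
Proof.
case: n => [|n]; split=> [|y z].
- by rewrite unfold_in.
- by rewrite !unfold_in /= => /eqP -> /eqP ->; rewrite subrr.
- by apply/asboolP; exists 0; rewrite raddf0.
- move=> /asboolP[f fy] /asboolP[h hz]; apply/asboolP.
  by exists (f - h); rewrite raddfB /= fy hz.
Qed.

HB.instance Definition _ n :=
  GRing.isZmodClosed.Build (cocycle n) (@exact_pred n) (@exact_zmod_closed n).

Definition bounded_cohomology n : zmodType := Quotient.quot (@exact_pred n).
End BoundedCohomology.

Definition in_Creg (R : realType) (G : groupType) : Prop :=
  countable [set: G] /\
  exists x : bounded_cohomology (regular_rep R G) 2, x != 0.

(* A left-invariant finitely additive probability measure on all subsets of N.
   The values of mu on sets not contained in N are irrelevant. *)
Definition amenable_subgroup (R : realType) (G : groupType) (N : {pred G}) :=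
  exists mu : set G -> R,
    [/\ forall A, 0 <= mu A,
        mu [set` N] = 1,
        forall A B, A `<=` [set` N] -> B `<=` [set` N] -> A `&` B = set0 ->
          mu (A `|` B) = mu A + mu B
      & forall g A, g \in N -> A `<=` [set` N] ->
          mu [set (g * x)%g | x in A] = mu A].

Definition normal_subgroup (G : groupType) (N : {pred G}) :=
  group_closed N /\ forall g x, x \in N -> (x ^ g)%g \in N.

(* A Borel isomorphism onto a Polish space P; a Hausdorff pseudometric is a
   metric. *)
Definition standard_borel (R : realType) (d : measure_display)
    (S : measurableType d) :=
  exists (P : completePseudoMetricType R) (phi : S -> P),
    [/\ hausdorff_space P,
        exists2 D : set P, countable D & dense D,
        bijective phi
      & forall A : set S, measurable A <-> <<s @open P >> (phi @` A)].

Record mp_action (R : realType) (G : groupType) (d : measure_display)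
    (S : measurableType d) (m : set S -> \bar R) := MpAction {
  act :> G -> S -> S;
  act1 : forall x, act 1%g x = x;
  actM : forall g h x, act (g * h)%g x = act g (act h x);
  act_measurable : forall g, measurable_fun setT (act g);
  act_preserving : forall g A, measurable A -> m (act g @^-1` A) = m A
}.

(* Up to a null set, the translates of F partition S. *)
Definition fundamental_domain (R : realType) (G : groupType)
    (d : measure_display) (S : measurableType d)
    (m : {measure set S -> \bar R}) (a : G -> S -> S) (F : set S) :=
  measurable F /\ {ae m, forall x, exists! g, (a g @` F) x}.

(* The zero measure has to be excluded: any two countable groups would be
   equivalent through it. *)
Definition measure_equivalent (R : realType) (G H : groupType) :=
  exists (d : measure_display) (S : measurableType d)
      (m : {measure set S -> \bar R}) (a : mp_action G m) (b : mp_action H m),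
    [/\ standard_borel R S, sigma_finite setT m, m setT != 0%E,
        forall g h x, a g (b h x) = b h (a g x)
      & (exists2 F, fundamental_domain m a F & (m F < +oo)%E) /\
        (exists2 F, fundamental_domain m b F & (m F < +oo)%E)].

(* Main.v *)
Require Import Defs.
From mathcomp Require Import all_boot all_order all_algebra.
From mathcomp Require Import all_classical all_reals all_analysis.
From mathcomp Require Import measurable_realfun complex.
From mathcomp Require Import lra ring.
Set Implicit Arguments.
Unset Strict Implicit.
Unset Printing Implicit Defensive.
Import Order.TTheory GRing.Theory Num.Theory.
Import numFieldNormedType.Exports.
Local Open Scope classical_set_scope.
Local Open Scope ring_scope.

(** Every bounded 2-cocycle of H with values in the regular representation is shown to be
    a coboundary, once H is coupled with G.

    Evaluation at 1 turns an invariant cochain into a scalar function f on a power of H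
    whose squares have bounded sums along the diagonal orbits x |-> (x h_0, ..., x h_n),
    uniformly in the h_i ([cochain_eval1], [cocycle_sq_le]); real and imaginary parts can
    be treated separately. A scalar cocycle becomes exact after its arguments are moved at
    random. Suppose that points h_i of H are replaced by random points k_i of H, in such a
    way that the joint laws of pairs and triples are consistent and equivariant under left
    translation. Let c(h_0, h_1) be the expectation of
      f(h_0, h_1, k_1) - f(h_0, k_0, k_1).
    The cocycle identity shows that f(h_0, h_1, h_2) is the coboundary of c plus the
    expectation of f(k_0, k_1, k_2) ([primitive_coboundary]), and the Cauchy-Schwarz
    inequality bounds the square sums of c ([primitive_sq]). The last expectation vanishes
    as soon as the law of (k_0, k_1, k_2) is zero on every set that meets the diagonal
    orbits in a bounded number of points ([mean_cocycle0]). Finitely additive laws are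
    enough for all this.

    The coupling S provides such points. Let kappa and chi be equivariant maps from S to G
    and to H, defined off a null set ([coupling_retractions]), and let Y be the
    fundamental domain where kappa is 1. Draw s in Y from the normalised measure, and for
    each i an element n_i of N from the invariant mean, independently. Put
      k_i = h_i chi(n_i^-1 kappa(h_i^-1 s)^-1 h_i^-1 s).
    Consistency and equivariance follow from the invariance of the measure
    ([mean_law2_translate]).

    For the vanishing, let E meet each diagonal orbit in at most K points, and cut Y into
    countably many pieces according to the values g_i of kappa(h_i^-1 s). On such a piece
    k_i = chi(n_i^-1 g_i^-1 s). The set D of all s in S for which the triple of these
    values lies in E meets each H-orbit in at most K points, hence its measure is at most
    K times that of a fundamental domain of H ([measure_drift_set]). Moving s by l in N
    multiplies n_i by g_i^-1 l^-1 g_i, an element of N, so the average over the n_i of the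
    measure of the intersection of D with l Y does not depend on l ([mean_drift_vol]).
    Since N is infinite and the translates l Y are disjoint, this average is zero
    ([mean_drift_vol0], [mean_law3_orbit_finite0]). *)

(** * Integration against finitely additive probabilities *)

Section FinitelyAdditiveProbability.
Variable R : realType.

(** An infinite countable group carries no translation-invariant countably additive
    probability, so expectations are taken with respect to this weaker notion. All subsets
    are measured, hence every bounded function has an expectation. *)
Record fap (T : Type) := Fap {
  fap_fun :> set T -> R;
  fap_ge0 : forall A, 0 <= fap_fun A;
  fap_setT : fap_fun setT = 1;
  fap_setU : forall A B, A `&` B = set0 ->
    fap_fun (A `|` B) = fap_fun A + fap_fun B
}.

Definition bounded_fct (T : Type) (f : T -> R) := exists C, forall t, `|f t| <= C.

Section Mean.
Variable T : Type.
Implicit Types (mu : fap T) (f g : T -> R) (s : seq (R * set T)) (A B : set T).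

(** A simple function is presented as a list of weighted sets, which may overlap and
    repeat: sums are then concatenations, and no common refinement has to be formed. *)
Definition simple_fct s (t : T) : R := \sum_(p <- s) p.1 * \1_(p.2) t.

Definition simple_sum (mu : set T -> R) s : R := \sum_(p <- s) p.1 * mu p.2.

(** The lower integral. On bounded functions it agrees with the upper one, by
    uniform approximation, which is why it is additive there. *)
Definition mean (mu : set T -> R) f : R :=
  sup [set simple_sum mu s | s in [set s | forall t, simple_fct s t <= f t]].

Definition scale_simple c s : seq (R * set T) := [seq (c * p.1, p.2) | p <- s].

Lemma simple_fct_cat s1 s2 t :
  simple_fct (s1 ++ s2) t = simple_fct s1 t + simple_fct s2 t.
Proof. by rewrite /simple_fct big_cat. Qed.

Lemma simple_sum_cat (mu : set T -> R) s1 s2 :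
  simple_sum mu (s1 ++ s2) = simple_sum mu s1 + simple_sum mu s2.
Proof. by rewrite /simple_sum big_cat. Qed.

Lemma simple_fct_cons p s t :
  simple_fct (p :: s) t = p.1 * \1_(p.2) t + simple_fct s t.
Proof. exact: big_cons. Qed.

Lemma simple_sum_cons (mu : set T -> R) p s :
  simple_sum mu (p :: s) = p.1 * mu p.2 + simple_sum mu s.
Proof. exact: big_cons. Qed.

Lemma simple_fct_nil t : simple_fct [::] t = 0.
Proof. exact: big_nil. Qed.

Lemma simple_sum_nil (mu : set T -> R) : simple_sum mu [::] = 0.
Proof. exact: big_nil. Qed.

Lemma simple_fct_scale c s t : simple_fct (scale_simple c s) t = c * simple_fct s t.
Proof.
by rewrite /simple_fct big_map mulr_sumr; apply: eq_bigr => p _ /=; rewrite mulrA.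
Qed.

Lemma simple_sum_scale (mu : set T -> R) c s :
  simple_sum mu (scale_simple c s) = c * simple_sum mu s.
Proof.
by rewrite /simple_sum big_map mulr_sumr; apply: eq_bigr => p _ /=; rewrite mulrA.
Qed.

Lemma fap_set0 mu : mu set0 = 0.
Proof.
have := fap_setU mu (set0I set0); rewrite setU0 => /eqP.
by rewrite -subr_eq0 opprD addNKr oppr_eq0 => /eqP.
Qed.

(** Independence of the presentation comes down to this positivity. Splitting [B] along
    the first set of the list turns its weight into a constant on each half, so that an
    induction on the list never meets intersections of several of its sets. *)
Lemma simple_sum_ge0_in mu s c B :
  (forall t, B t -> 0 <= c + simple_fct s t) ->
  0 <= c * mu B + \sum_(p <- s) p.1 * mu (p.2 `&` B).
Proof.
elim: s c B => [|[a A] s IH] c B h.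
  rewrite big_nil addr0; have [[t Bt]|B0] := pselect (exists t, B t).
    by rewrite mulr_ge0 ?fap_ge0 //; have := h t Bt; rewrite simple_fct_nil addr0.
  have -> : B = set0 by apply/seteqP; split=> t // Bt; case: B0; exists t.
  by rewrite fap_set0 mulr0.
have cut (C : set T) : mu C = mu (A `&` C) + mu (C `\` A).
  rewrite -fap_setU; last by apply/seteqP; split=> t //= [[? ?] [? ?]].
  congr (mu _); apply/seteqP; split=> t /=; last by case=> -[].
  by move=> Ct; have [At|At] := pselect (A t); [left|right].
have h1 t : (A `&` B) t -> 0 <= c + a + simple_fct s t.
  move=> [At Bt]; have := h t Bt; rewrite simple_fct_cons /= indicE mem_set //.
  by rewrite mulr1 addrA.
have h2 t : (B `\` A) t -> 0 <= c + simple_fct s t.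
  move=> [Bt At]; have := h t Bt; rewrite simple_fct_cons /= indicE memNset //.
  by rewrite mulr0 add0r.
have := addr_ge0 (IH _ _ h1) (IH _ _ h2).
rewrite big_cons /= addrACA -big_split /= (cut B).
under eq_bigr => p _.
  rewrite -mulrDr (_ : mu (_ `&` (A `&` B)) + _ = mu (p.2 `&` B)); last first.
    rewrite (cut (_ `&` B)) setICA; congr (_ + mu _).
    by apply/seteqP; split=> t /=; tauto.
  over.
by move=> /le_trans; apply; rewrite le_eqVlt; apply/orP; left; apply/eqP; ring.
Qed.

Lemma simple_sum_ge0 mu s : (forall t, 0 <= simple_fct s t) -> 0 <= simple_sum mu s.
Proof.
move=> h; have := @simple_sum_ge0_in mu s 0 setT; rewrite mul0r add0r.
rewrite /simple_sum; under eq_bigr do rewrite setIT.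
by apply=> t _; rewrite add0r.
Qed.

Lemma simple_sum_le mu s1 s2 e :
  (forall t, simple_fct s1 t <= simple_fct s2 t + e) ->
  simple_sum mu s1 <= simple_sum mu s2 + e.
Proof.
move=> h; have := @simple_sum_ge0 mu ((e, setT) :: s2 ++ scale_simple (-1) s1).
rewrite simple_sum_cons fap_setT simple_sum_cat simple_sum_scale mulr1 mulN1r => h'.
suff : 0 <= e + (simple_sum mu s2 - simple_sum mu s1) by lra.
apply: h' => t; rewrite simple_fct_cons indicT /= mulr1.
by rewrite simple_fct_cat simple_fct_scale; have := h t; lra.
Qed.

(** One layer of height [e] is cut off where it fits under [f]; the remainder is
    bounded by one layer less. *)
Lemma simple_approx_ge0 e n f : 0 < e -> (forall t, 0 <= f t <= n.+1%:R * e) ->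
  exists s, forall t, simple_fct s t <= f t <= simple_fct s t + e.
Proof.
move=> e0; elim: n f => [|n IH] f fn.
  by exists [::] => t; have := fn t; rewrite mul1r simple_fct_nil add0r.
pose A := [set t | e <= f t].
have [|s hs] := IH (fun t => f t - e * \1_A t).
  move=> t; have /andP[f0 fe] := fn t; rewrite indicE.
  have ne : e <= n.+1%:R * e by rewrite ler_peMl ?(ltW e0) ?ler1n.
  have [At|At] := pselect (A t).
    rewrite mem_set // mulr1; move: At fe; rewrite /A /= -natr1 mulrDl mul1r; lra.
  rewrite memNset //; move/negP: At; rewrite /A /= -ltNge; lra.
exists ((e, A) :: s) => t; have := hs t.
rewrite simple_fct_cons /=; lra.
Qed.

Lemma simple_approx f e : bounded_fct f -> 0 < e ->
  exists s, forall t, simple_fct s t <= f t <= simple_fct s t + e.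
Proof.
move=> [C fC] e0.
have [n Cn] : exists n, 2 * `|C| <= n.+1%:R * e.
  exists (Num.truncn (2 * `|C| / e)); rewrite -ler_pdivrMr // ltW //.
  exact: truncnS_gt.
have [|s hs] := @simple_approx_ge0 e n (fun t => f t + `|C|) e0.
  move=> t; have := fC t; have := ler_norm C; have := ler_norm (f t).
  by have := lerNnormlW (lexx `|f t|); lra.
exists ((- `|C|, setT) :: s) => t; have := hs t.
rewrite simple_fct_cons indicT /= mulr1; lra.
Qed.

Lemma mean_approx mu f e : bounded_fct f -> 0 < e ->
  exists s, (forall t, `|f t - simple_fct s t| <= e) /\
            `|mean mu f - simple_sum mu s| <= e.
Proof.
move=> bf e0; have [s hs] := simple_approx bf e0.
exists s; split=> [t|]; first by have := hs t; rewrite ler_norml; lra.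
have ub : ubound [set simple_sum mu s | s in [set s | forall t, simple_fct s t <= f t]]
    (simple_sum mu s + e).
  move=> _ [s' /= h <-]; apply: simple_sum_le => t.
  by have := hs t; have := h t; lra.
have mem : [set simple_sum mu s | s in [set s | forall t, simple_fct s t <= f t]]
    (simple_sum mu s).
  by exists s => // t /=; have := hs t; lra.
have lo : simple_sum mu s <= mean mu f by apply: ub_le_sup => //; exists (simple_sum mu s + e).
have hi : mean mu f <= simple_sum mu s + e by apply: ge_sup => //; exists (simple_sum mu s).
by rewrite ler_norml; lra.
Qed.

(** Together with [mean_approx] this characterises the mean without reference to the
    supremum; each algebraic rule below is proved by transforming approximating lists. *)
Lemma mean_uniq mu f r :
  (forall e, 0 < e -> exists s, (forall t, `|f t - simple_fct s t| <= e) /\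
                                `|r - simple_sum mu s| <= e) ->
  mean mu f = r.
Proof.
move=> h; have bf : bounded_fct f.
  have [s [hs _]] := h 1 ltr01.
  have [C hC] : exists C, forall t, `|simple_fct s t| <= C.
    exists (\sum_(p <- s) `|p.1|) => t; rewrite (le_trans (ler_norm_sum _ _ _)) //.
    apply: ler_sum => p _; rewrite normrM ler_piMr // indicE.
    by case: (_ \in _); rewrite ?normr1 ?normr0 ?ler01.
  exists (1 + C) => t; rewrite -(subrK (simple_fct s t) (f t)).
  by rewrite (le_trans (ler_normD _ _)) // lerD.
apply/eqP; rewrite -subr_eq0 -normr_eq0 eq_le normr_ge0 andbT.
apply/ler_addgt0Pr => e e0; rewrite add0r.
have e4 : 0 < e / 4 by rewrite divr_gt0.
have [s [hs hr]] := h _ e4; have [s' [hs' hr']] := mean_approx mu bf e4.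
have d1 := @simple_sum_le mu s s' (e / 2); have d2 := @simple_sum_le mu s' s (e / 2).
have {}d1 : simple_sum mu s <= simple_sum mu s' + e / 2.
  by apply: d1 => t; have := hs t; have := hs' t; rewrite !ler_norml; lra.
have {}d2 : simple_sum mu s' <= simple_sum mu s + e / 2.
  by apply: d2 => t; have := hs t; have := hs' t; rewrite !ler_norml; lra.
by move: hr hr'; rewrite !ler_norml; lra.
Qed.

Lemma bounded_fctD f g : bounded_fct f -> bounded_fct g -> bounded_fct (fun t => f t + g t).
Proof.
move=> [C fC] [D gD]; exists (C + D) => t.
by rewrite (le_trans (ler_normD _ _)) // lerD.
Qed.

Lemma bounded_fctZ c f : bounded_fct f -> bounded_fct (fun t => c * f t).
Proof. by move=> [C fC]; exists (`|c| * C) => t; rewrite normrM ler_wpM2l. Qed.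

Lemma bounded_fctB f g : bounded_fct f -> bounded_fct g -> bounded_fct (fun t => f t - g t).
Proof.
move=> [C fC] [D gD]; exists (C + D) => t.
by rewrite (le_trans (ler_normB _ _)) // lerD.
Qed.

Lemma bounded_fct_cst c : bounded_fct (fun _ : T => c).
Proof. by exists `|c|. Qed.

Lemma bounded_fct_sum (I : Type) (r : seq I) (F : I -> T -> R) :
  (forall i, bounded_fct (F i)) -> bounded_fct (fun t => \sum_(i <- r) F i t).
Proof.
move=> bF; elim: r => [|i r IH].
  by under eq_fun do rewrite big_nil; exact: bounded_fct_cst.
by under eq_fun do rewrite big_cons; exact: bounded_fctD.
Qed.

Lemma meanD mu f g : bounded_fct f -> bounded_fct g ->
  mean mu (fun t => f t + g t) = mean mu f + mean mu g.
Proof.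
move=> bf bg; apply: mean_uniq => e e0; have e2 : 0 < e / 2 by rewrite divr_gt0.
have [s [hs ms]] := mean_approx mu bf e2; have [s' [hs' ms']] := mean_approx mu bg e2.
exists (s ++ s'); split=> [t|].
  rewrite simple_fct_cat; have := hs t; have := hs' t; rewrite !ler_norml; lra.
by rewrite simple_sum_cat; move: ms ms'; rewrite !ler_norml; lra.
Qed.

Lemma meanZ mu c f : bounded_fct f -> mean mu (fun t => c * f t) = c * mean mu f.
Proof.
move=> bf; apply: mean_uniq => e e0.
have ec : 0 < e / (1 + `|c|) by rewrite divr_gt0 // ltr_pwDl.
have ce : `|c| * (e / (1 + `|c|)) <= e.
  rewrite mulrCA ler_piMr ?(ltW e0) // ler_pdivrMr ?ltr_pwDl //.
  by rewrite mul1r lerDr.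
have [s [hs ms]] := mean_approx mu bf ec.
exists (scale_simple c s); split=> [t|].
  rewrite simple_fct_scale -mulrBr normrM (le_trans _ ce) //.
  by rewrite ler_wpM2l.
by rewrite simple_sum_scale -mulrBr normrM (le_trans _ ce) // ler_wpM2l.
Qed.

Lemma mean_cst mu c : mean mu (fun=> c) = c.
Proof.
apply: mean_uniq => e e0; exists [:: (c, setT)].
rewrite /simple_sum big_seq1 fap_setT mulr1 subrr normr0 ltW //; split=> // t.
by rewrite /simple_fct big_seq1 /= indicT mulr1 subrr normr0 ltW.
Qed.

Lemma meanB mu f g : bounded_fct f -> bounded_fct g ->
  mean mu (fun t => f t - g t) = mean mu f - mean mu g.
Proof.
move=> bf bg; rewrite -mulN1r -meanZ // -meanD //; last exact: bounded_fctZ.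
by under eq_fun do rewrite -mulN1r.
Qed.

Lemma mean_sum mu (I : Type) (r : seq I) (F : I -> T -> R) :
  (forall i, bounded_fct (F i)) ->
  mean mu (fun t => \sum_(i <- r) F i t) = \sum_(i <- r) mean mu (F i).
Proof.
move=> bF; elim: r => [|i r IH].
  by under eq_fun do rewrite big_nil; rewrite big_nil mean_cst.
rewrite big_cons -IH -meanD //; last exact: bounded_fct_sum.
by under eq_fun do rewrite big_cons.
Qed.

Lemma le_mean mu f g : bounded_fct f -> bounded_fct g ->
  (forall t, f t <= g t) -> mean mu f <= mean mu g.
Proof.
move=> bf bg fg; rewrite -subr_ge0 -meanB //; apply/ler_addgt0Pr => e e0.
have e2 : 0 < e / 2 by rewrite divr_gt0.
have [s [hs ms]] := mean_approx mu (bounded_fctB bg bf) e2.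
have := @simple_sum_le mu [::] s (e / 2).
rewrite simple_sum_nil => h.
have {}h : 0 <= simple_sum mu s + e / 2.
  by apply: h => t; rewrite simple_fct_nil; have := hs t; have := fg t; rewrite ler_norml; lra.
by move: ms; rewrite ler_norml; lra.
Qed.

Lemma mean_ge0 mu f : bounded_fct f -> (forall t, 0 <= f t) -> 0 <= mean mu f.
Proof. by move=> bf f0; rewrite -(mean_cst mu 0) le_mean //; exact: bounded_fct_cst. Qed.

Lemma mean_le_cst mu f c : bounded_fct f -> (forall t, f t <= c) -> mean mu f <= c.
Proof. by move=> bf f0; rewrite -(mean_cst mu c) le_mean //; exact: bounded_fct_cst. Qed.

Lemma mean_indic mu A : mean mu \1_A = mu A.
Proof.
apply: mean_uniq => e e0; exists [:: (1, A)]; split=> [t|].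
  by rewrite /simple_fct big_seq1 mul1r subrr normr0 ltW.
by rewrite /simple_sum big_seq1 mul1r subrr normr0 ltW.
Qed.

(** The Cauchy-Schwarz inequality for a vector-valued mean. With v i the mean of F i
    and S the sum of the v i ^+ 2, S is the mean of the sum of the v i * F i, which is
    pointwise at most (S + C) / 2. *)
Lemma mean_sumsq_le mu (I : Type) (r : seq I) (F : I -> T -> R) C :
  (forall i, bounded_fct (F i)) ->
  (forall t, \sum_(i <- r) F i t ^+ 2 <= C) ->
  \sum_(i <- r) mean mu (F i) ^+ 2 <= C.
Proof.
move=> bF FC; set S := \sum_(i <- r) _.
have bvF i : bounded_fct (fun t => mean mu (F i) * F i t) by exact: bounded_fctZ.
have SE : S = mean mu (fun t => \sum_(i <- r) mean mu (F i) * F i t).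
  by rewrite mean_sum //; apply: eq_bigr => i _; rewrite meanZ // expr2.
suff : S <= (S + C) / 2 by lra.
rewrite [X in X <= _]SE; apply: mean_le_cst; first exact: bounded_fct_sum.
move=> t; rewrite ler_pdivlMr // (@le_trans _ _ (S + \sum_(i <- r) F i t ^+ 2)) ?lerD2l //.
rewrite mulr_suml -big_split /=; apply: ler_sum => i _.
by have := sqr_ge0 (mean mu (F i) - F i t); rewrite sqrrB; lra.
Qed.
End Mean.

(** Change of variables; with [nu = mu] it expresses invariance of the mean. *)
Lemma mean_pushforward (T U : Type) (mu : fap T) (nu : fap U) (p : T -> U) (f : U -> R) :
  (forall A, nu A = mu (p @^-1` A)) -> bounded_fct f ->
  mean nu f = mean mu (f \o p).
Proof.
move=> nuE bf; apply/esym/mean_uniq => e e0.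
have [s [hs ms]] := mean_approx nu bf e0.
exists [seq (q.1, p @^-1` q.2) | q <- s]; split=> [t|].
  rewrite (_ : simple_fct _ t = simple_fct s (p t)) ?hs //.
  by rewrite /simple_fct big_map; apply: eq_bigr => q _; rewrite /= !indicE.
rewrite (_ : simple_sum mu _ = simple_sum nu s) //.
by rewrite /simple_sum big_map; apply: eq_bigr => q _; rewrite /= nuE.
Qed.

Lemma fap_le1 (T : Type) (mu : fap T) A : mu A <= 1.
Proof.
by rewrite -mean_indic; apply: mean_le_cst => [|t]; rewrite ?indicE;
  [exists 1 => t; rewrite indicE|]; case: (_ \in _); rewrite ?normr1 ?normr0 ?ler01.
Qed.

Lemma bounded_fap (S T : Type) (q : S -> fap T) A : bounded_fct (fun s => q s A).
Proof. by exists 1 => s; rewrite ger0_norm ?fap_ge0 ?fap_le1. Qed.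

(** The law of a point drawn from the random law [q s], with [s] drawn from [mu]. *)
Program Definition fap_bind (S T : Type) (mu : fap S) (q : S -> fap T) : fap T :=
  @Fap T (fun A => mean mu (fun s => q s A)) _ _ _.
Next Obligation.
by move=> S T mu q A; apply: mean_ge0 => [|s]; [exact: bounded_fap|exact: fap_ge0].
Qed.
Next Obligation.
by move=> S T mu q /=; under eq_fun do rewrite fap_setT; exact: mean_cst.
Qed.
Next Obligation.
move=> S T mu q A B AB /=; rewrite -meanD; [|exact: bounded_fap..].
by under eq_fun do rewrite fap_setU //.
Qed.

Program Definition fap_map (S T : Type) (p : S -> T) (mu : fap S) : fap T :=
  @Fap T (fun A => mu (p @^-1` A)) _ _ _.
Next Obligation. by move=> *; exact: fap_ge0. Qed.
Next Obligation. by move=> S T p mu; exact: (fap_setT mu). Qed.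
Next Obligation.
move=> S T p mu A B AB; apply: (fap_setU mu (A := p @^-1` A)).
by rewrite -preimage_setI AB preimage_set0.
Qed.

(** Independent draws. The two factors do not play symmetric roles, since Fubini's
    theorem fails for finitely additive measures. *)
Definition fap_prod (S T : Type) (mu : fap S) (nu : fap T) : fap (S * T) :=
  fap_bind mu (fun s => fap_map (pair s) nu).

End FinitelyAdditiveProbability.

(** * Equivariant retractions of a coupling *)

Lemma countable_injection (T : Type) : countable [set: T] ->
  exists i : T -> nat, injective i.
Proof.
by move=> /countable_injP[i ii]; exists i => x y; apply: ii; rewrite in_setT.
Qed.

Lemma fiber_cases (T : Type) (i : T -> nat) j :
  (exists t, i t = j) \/ (forall t, i t <> j).
Proof.
have [e|ne] := pselect (exists t, i t = j); first by left.
by right=> t tj; apply: ne; exists t.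
Qed.

Section CountableFamilies.
Variables (R : realType) (d : measure_display) (S : measurableType d).
Variables (m : {measure set S -> \bar R}) (T : Type).
Hypothesis countT : countable [set: T].

Lemma bigcup_injection (i : T -> nat) (F : T -> set S) :
  \bigcup_t F t = \bigcup_n \bigcup_(t in [set t | i t = n]) F t.
Proof.
apply/seteqP; split=> s [t]; first by exists (i t) => //; exists t.
by move=> _ [u _ Fu]; exists u.
Qed.

(** A countable union over [T] is rewritten as one over [nat] whose terms are single
    members of the family or empty. *)
Lemma fiber_bigcup (i : T -> nat) (F : T -> set S) n (P : set S -> Prop) : injective i ->
  P set0 -> (forall t, P (F t)) -> P (\bigcup_(t in [set t | i t = n]) F t).
Proof.
move=> ii P0 PF; have [[t tn]|ne] := fiber_cases i n; last first.
  rewrite (_ : [set t | i t = n] = set0) ?bigcup_set0 //.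
  by apply/seteqP; split=> t // /ne.
rewrite (_ : [set t | i t = n] = [set t]) ?bigcup_set1 //.
apply/seteqP; split=> u /=; first by rewrite -tn => /ii.
by move=> ->.
Qed.

Lemma measurable_countable_bigcup (F : T -> set S) :
  (forall t, measurable (F t)) -> measurable (\bigcup_t F t).
Proof.
move=> mF; have [i ii] := countable_injection countT.
rewrite (bigcup_injection i); apply: bigcupT_measurable => n.
exact: (@fiber_bigcup i F n measurable ii measurable0 mF).
Qed.

Lemma measurable_countable_bigcap (F : T -> set S) :
  (forall t, measurable (F t)) -> measurable (\bigcap_t F t).
Proof.
move=> mF; rewrite -(setCK (\bigcap_t _)) setC_bigcap; apply: measurableC.
by apply: measurable_countable_bigcup => t; exact: measurableC.
Qed.

Lemma null_countable_bigcup (F : T -> set S) :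
  (forall t, measurable (F t)) -> (forall t, m (F t) = 0%E) ->
  m (\bigcup_t F t) = 0%E.
Proof.
move=> mF F0; have [i ii] := countable_injection countT.
apply/negligibleP; first exact: measurable_countable_bigcup.
rewrite (bigcup_injection i); apply: negligible_bigcup => n.
have nF t : m.-negligible (F t) by exists (F t); split.
exact: (@fiber_bigcup i F n m.-negligible ii (negligible_set0 m) nF).
Qed.

Lemma conull_countable_bigcap (F : T -> set S) :
  (forall t, measurable (F t)) -> (forall t, m (~` F t) = 0%E) ->
  m (~` \bigcap_t F t) = 0%E.
Proof.
move=> mF F0; rewrite setC_bigcap; apply: null_countable_bigcup => // t.
exact: measurableC.
Qed.
End CountableFamilies.

Section Action.
Variables (R : realType) (G : groupType) (d : measure_display) (S : measurableType d).
Variables (m : {measure set S -> \bar R}) (a : mp_action G m).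

Lemma actK g : cancel (a g) (a g^-1%g).
Proof. by move=> s; rewrite -actM mulVg act1. Qed.

Lemma actKV g : cancel (a g^-1%g) (a g).
Proof. by move=> s; rewrite -actM mulgV act1. Qed.

Lemma image_act g (A : set S) : a g @` A = a g^-1%g @^-1` A.
Proof.
apply/seteqP; split=> s /=; first by move=> [t At <-]; rewrite actK.
by move=> As; exists (a g^-1%g s) => //; rewrite actKV.
Qed.

Lemma measurable_preimage_act g (A : set S) : measurable A -> measurable (a g @^-1` A).
Proof.
by move=> mA; rewrite -[X in measurable X]setTI; exact: act_measurable.
Qed.

Definition equivariant_on (Om : set S) (kappa : S -> G) :=
  forall g s, Om s -> kappa (a g s) = (g * kappa s)%g.

(** The points that lie in exactly one translate of the fundamental domain form an
    invariant conull set, on which the index of that translate is equivariant. *)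
Lemma fundamental_domain_retraction F : countable [set: G] ->
  fundamental_domain m a F ->
  exists Om kappa,
    [/\ measurable Om, m (~` Om) = 0%E, forall g s, Om (a g s) <-> Om s,
        equivariant_on Om kappa
      & forall g, Om `&` kappa @^-1` [set g] = Om `&` a g^-1%g @^-1` F].
Proof.
move=> cG [mF aeF].
pose Om := [set s | exists! g, (a g @` F) s].
pose kappa s := xget 1%g [set g | (a g @` F) s].
have mI g : measurable (a g @` F) by rewrite image_act; exact: measurable_preimage_act.
have mOm : measurable Om.
  have -> : Om = \bigcup_g (a g @` F `&` \bigcap_h (~` (a h @` F) `|` [set s | h = g])).
    apply/seteqP; split=> s.
      move=> [g [Fg ug]]; exists g => //; split=> // h _.
      by have [/ug ->|Fh] := pselect ((a h @` F) s); [right|left].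
    move=> [g _ [Fg Fh]]; exists g; split=> // h Fhs; apply/esym.
    by have [] := Fh h I.
  apply: measurable_countable_bigcup => // g; apply: measurableI => //.
  apply: measurable_countable_bigcap => // h; apply: measurableU.
    exact: measurableC.
  have [hg|hg] := pselect (h = g).
    by rewrite (_ : [set _ | _] = setT) //; apply/seteqP; split.
  by rewrite (_ : [set _ | _] = set0) //; apply/seteqP; split.
have transl g h s : (a (g * h)%g @` F) (a g s) <-> (a h @` F) s.
  by rewrite !image_act /= -actM invgM mulgVK.
have kappaP s : Om s -> (a (kappa s) @` F) s.
  by move=> [g [Fg _]]; exact: (xgetPex 1%g (P := [set g | (a g @` F) s]) (ex_intro _ g Fg)).
have kappa_uniq s g : Om s -> (a g @` F) s -> kappa s = g.
  by move=> Oms Fg; have [h [_ uh]] := Oms; rewrite -(uh _ Fg) -(uh _ (kappaP s Oms)).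
have OmI g s : Om s -> Om (a g s).
  move=> [h [Fh uh]]; exists (g * h)%g; split; first exact/transl.
  move=> k; rewrite -{1}(mulVKg g k) => /transl /uh ->.
  by rewrite mulVKg.
exists Om, kappa; split=> //.
- exact/negligibleP/aeF/measurableC.
- by move=> g s; split; [rewrite -{2}(actK g s)|]; exact: OmI.
- by move=> g s Oms; apply: kappa_uniq; [exact: OmI|exact/transl/kappaP].
- move=> g; apply/seteqP; split=> s [Oms /=].
    by move=> <-; split=> //=; have := kappaP s Oms; rewrite image_act.
  by move=> Fg; split=> //; apply: kappa_uniq => //; rewrite image_act.
Qed.
End Action.

(** The set [Om] carries the exact form of a fundamental domain, namely the fiber of
    [kappa] over 1, with no exceptional null set. When a second group acts, [Om] can be
    chosen invariant under both. *)
Record retraction (R : realType) (G : groupType) (d : measure_display)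
    (S : measurableType d) (m : {measure set S -> \bar R}) (a : mp_action G m)
    (Om : set S) (kappa : S -> G) : Prop := Retraction {
  retr_inv : forall g s, Om (a g s) <-> Om s;
  retr_equiv : equivariant_on a Om kappa;
  retr_meas : forall g, measurable (Om `&` kappa @^-1` [set g]);
  retr_fin : (m (Om `&` kappa @^-1` [set 1%g]) < +oo)%E
}.

Lemma retraction_restrict (R : realType) (G : groupType) (d : measure_display)
    (S : measurableType d) (m : {measure set S -> \bar R}) (a : mp_action G m)
    Om Om' kappa F :
  measurable F -> (m F < +oo)%E ->
  measurable Om' -> Om' `<=` Om -> (forall g s, Om' (a g s) <-> Om' s) ->
  equivariant_on a Om kappa ->
  (forall g, Om `&` kappa @^-1` [set g] = Om `&` a g^-1%g @^-1` F) ->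
  retraction a Om' kappa.
Proof.
move=> mF finF mOm' sub inv eqv fib.
have fib' g : Om' `&` kappa @^-1` [set g] = Om' `&` a g^-1%g @^-1` F.
  by rewrite -(setIidl sub) -!setIA fib.
have mfib g : measurable (Om' `&` kappa @^-1` [set g]).
  by rewrite fib'; apply: measurableI => //; exact: measurable_preimage_act.
split=> //; first by move=> g s /sub; exact: eqv.
apply: le_lt_trans finF; apply: le_measure; rewrite ?inE //.
by rewrite fib' => s [_]; rewrite /= invg1 act1.
Qed.

Section Coupling.
Variables (R : realType) (G H : groupType) (d : measure_display) (S : measurableType d).
Variables (m : {measure set S -> \bar R}) (a : mp_action G m) (b : mp_action H m).

(** Each good set is invariant under its own group only; intersecting its translates
    under the other, countable, group repairs this and keeps it conull, because the
    actions commute. *)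
Lemma coupling_retractions E F : countable [set: G] -> countable [set: H] ->
  (forall g h s, a g (b h s) = b h (a g s)) ->
  fundamental_domain m a E -> (m E < +oo)%E ->
  fundamental_domain m b F -> (m F < +oo)%E ->
  exists Om kappa chi,
    [/\ measurable Om, m (~` Om) = 0%E, retraction a Om kappa & retraction b Om chi].
Proof.
move=> cG cH ab fE finE fF finF.
have [Da [kappa [mO1 nO1 O1I eqk fibk]]] := fundamental_domain_retraction cG fE.
have [Db [chi [mO2 nO2 O2I eqc fibc]]] := fundamental_domain_retraction cH fF.
pose Da' := \bigcap_h (b h @^-1` Da); pose Db' := \bigcap_g (a g @^-1` Db).
have mb h A : measurable A -> measurable (b h @^-1` A) by exact: measurable_preimage_act.
have ma g A : measurable A -> measurable (a g @^-1` A) by exact: measurable_preimage_act.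
have m1 : measurable Da' by apply: measurable_countable_bigcap => // h; exact: mb.
have m2 : measurable Db' by apply: measurable_countable_bigcap => // g; exact: ma.
have nu1 : m (~` Da') = 0%E.
  apply: conull_countable_bigcap => // h; first exact: mb.
  by rewrite preimage_setC act_preserving //; exact: measurableC.
have nu2 : m (~` Db') = 0%E.
  apply: conull_countable_bigcap => // g; first exact: ma.
  by rewrite preimage_setC act_preserving //; exact: measurableC.
have inv1 (a' : S -> S) (s : S) : (forall h t, a' (b h t) = b h (a' t)) ->
    (forall t, Da (a' t) <-> Da t) -> Da' (a' s) <-> Da' s.
  move=> comm inv; split=> Os h _ /=.
    by apply/inv; rewrite comm; exact: Os.
  by rewrite -comm; apply/inv; exact: Os.
have inv2 (b' : S -> S) (s : S) : (forall h t, b' (a h t) = a h (b' t)) ->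
    (forall t, Db (b' t) <-> Db t) -> Db' (b' s) <-> Db' s.
  move=> comm inv; split=> Os h _ /=.
    by apply/inv; rewrite comm; exact: Os.
  by rewrite -comm; apply/inv; exact: Os.
have inv1b h s : Da' (b h s) <-> Da' s.
  split=> Os k _ /=; last by rewrite -actM; exact: Os.
  by rewrite -(mulgVK h k) actM; exact: Os.
have inv2a h s : Db' (a h s) <-> Db' s.
  split=> Os k _ /=; last by rewrite -actM; exact: Os.
  by rewrite -(mulgVK h k) actM; exact: Os.
have sub1 : Da' `&` Db' `<=` Da.
  by move=> s [/(_ 1%g I)]; rewrite /= act1.
have sub2 : Da' `&` Db' `<=` Db.
  by move=> s [_ /(_ 1%g I)]; rewrite /= act1.
exists (Da' `&` Db'), kappa, chi; split.
- exact: measurableI.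
- by rewrite setCI measureU0 //; exact: measurableC.
- apply: (retraction_restrict _ finE _ sub1 _ eqk fibk) => //; first exact: fE.1.
    exact: measurableI.
  move=> g s; have i1 := inv1 (a g) s (ab g) (O1I g); have i2 := inv2a g s.
  by split=> -[? ?]; split; [exact/i1|exact/i2|exact/i1|exact/i2].
- apply: (retraction_restrict _ finF _ sub2 _ eqc fibc) => //; first exact: fF.1.
    exact: measurableI.
  move=> g s; have i2 := inv2 (b g) s (fun h t => esym (ab h g t)) (O2I g).
  have i1 := inv1b g s.
  by split=> -[? ?]; split; [exact/i1|exact/i2|exact/i1|exact/i2].
Qed.
End Coupling.

(** * Maps with measurable preimages of all sets *)

Section DiscreteMaps.
Variables (d : measure_display) (S : measurableType d) (Om : set S).

(** For maps with countably many values this is the usual measurability; asking it for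
    all subsets spares the targets, which are groups and products of groups, a sigma-algebra. *)
Definition discretely_measurable (T : Type) (v : S -> T) :=
  forall A : set T, measurable (Om `&` v @^-1` A).

Lemma dmeas_countable (T : Type) (v : S -> T) : countable [set: T] ->
  (forall t, measurable (Om `&` v @^-1` [set t])) -> discretely_measurable v.
Proof.
move=> cT mv A.
have -> : Om `&` v @^-1` A = \bigcup_t (if `[< A t >] then Om `&` v @^-1` [set t] else set0).
  apply/seteqP; split=> s.
    by move=> [Oms As]; exists (v s) => //; rewrite asboolT.
  by move=> [t _]; case: asboolP => // At [Oms /= vt]; split=> //=; rewrite vt.
apply: measurable_countable_bigcup => // t; by case: ifP => _; [exact: mv|exact: measurable0].
Qed.

Lemma dmeas_map (T U : Type) (v : S -> T) (p : T -> U) :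
  discretely_measurable v -> discretely_measurable (p \o v).
Proof. by move=> mv A; exact: (mv (p @^-1` A)). Qed.

(** Gluing along a countable measurable partition. *)
Lemma dmeas_bind (T U : Type) (v : S -> T) (w : T -> S -> U) :
  countable [set: T] -> discretely_measurable v ->
  (forall t, discretely_measurable (w t)) -> discretely_measurable (fun s => w (v s) s).
Proof.
move=> cT mv mw A.
have -> : Om `&` (fun s => w (v s) s) @^-1` A =
    \bigcup_t ((Om `&` v @^-1` [set t]) `&` (Om `&` w t @^-1` A)).
  apply/seteqP; split=> s; first by move=> [Oms As]; exists (v s).
  by move=> [t _ [[Oms /= <-] [_ As]]].
apply: measurable_countable_bigcup => // t.
by apply: measurableI; [exact: mv|exact: mw].
Qed.

Lemma dmeas_pair (T U : Type) (v : S -> T) (w : S -> U) : countable [set: T] ->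
  discretely_measurable v -> discretely_measurable w ->
  discretely_measurable (fun s => (v s, w s)).
Proof.
move=> cT mv mw; apply: (dmeas_bind (w := fun t s => (t, w s)) cT mv) => t.
exact: (dmeas_map (pair t) mw).
Qed.

Lemma dmeas_comp (T : Type) (v : S -> T) (f : S -> S) : measurable_fun setT f ->
  (forall s, Om (f s) <-> Om s) -> discretely_measurable v ->
  discretely_measurable (v \o f).
Proof.
move=> mf inv mv A.
have -> : Om `&` (v \o f) @^-1` A = f @^-1` (Om `&` v @^-1` A).
  by apply/seteqP; split=> s [Oms As]; split=> //; exact/inv.
by rewrite -[X in measurable X]setTI; exact: mf.
Qed.
End DiscreteMaps.

(** * Two consequences of mass transport *)

Section MassTransport.
Variables (R : realType) (G : groupType) (d : measure_display) (S : measurableType d).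
Variables (m : {measure set S -> \bar R}) (a : mp_action G m).
Variables (Om : set S) (countG : countable [set: G]).

Lemma retraction_dmeas (kappa : S -> G) : retraction a Om kappa ->
  discretely_measurable Om kappa.
Proof. by move=> rk; apply: dmeas_countable => //; exact: (retr_meas rk). Qed.

Lemma measure_fibers (T : Type) (i : T -> nat) (v : S -> T) (D : set S) :
  discretely_measurable Om v -> measurable D -> D `<=` Om ->
  m D = (\sum_(j <oo) m (D `&` [set s | i (v s) = j]))%E.
Proof.
move=> mv mD DO; rewrite -measure_semi_bigcup.
- congr (m _); apply/seteqP; split=> s; last by case=> j _ [].
  by move=> Ds; exists (i (v s)).
- move=> j; rewrite -(setIidl DO) -setIA; apply: measurableI => //.
  exact: (mv [set t | i t = j]).
- by move=> j k _ _ [s [[_ /= <-] [_ /= <-]]].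
- apply: bigcupT_measurable => j; rewrite -(setIidl DO) -setIA; apply: measurableI => //.
  exact: (mv [set t | i t = j]).
Qed.

Lemma measure_act g (A : set S) : measurable A -> m (a g @` A) = m A.
Proof. by move=> mA; rewrite image_act act_preserving. Qed.

(** Two fundamental domains give an invariant set the same trace: the piece where
    [kappa] is 1 and [kappa'] is g is translated by g^-1 onto the piece where [kappa'] is
    1 and [kappa] is g^-1. *)
Lemma measure_invariant_domain (kappa kappa' : S -> G) (P : set S) :
  retraction a Om kappa -> retraction a Om kappa' ->
  measurable P -> P `<=` Om -> (forall g s, P (a g s) <-> P s) ->
  m (P `&` kappa @^-1` [set 1%g]) = m (P `&` kappa' @^-1` [set 1%g]).
Proof.
move=> rk rk' mP PO invP; have [i ii] := countable_injection countG.
have dk := retraction_dmeas rk; have dk' := retraction_dmeas rk'.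
have mI (T : Type) (v : S -> T) A : discretely_measurable Om v -> measurable (P `&` v @^-1` A).
  by move=> mv; rewrite -(setIidl PO) -setIA; apply: measurableI => //; exact: mv.
have PkO (v : S -> G) : P `&` v @^-1` [set 1%g] `<=` Om by move=> s [/PO].
rewrite (measure_fibers i dk') //; last exact: mI.
have dk1 := dmeas_map (fun g : G => g^-1)%g dk.
rewrite [RHS](measure_fibers i dk1) //; last exact: mI.
apply: eq_eseriesr => j _.
have [[g gj]|ne] := fiber_cases i j; last first.
  have E0 (Q : set S) (v : S -> G) : Q `&` [set s | i (v s) = j] = set0.
    by rewrite -subset0 => s [_ /ne].
  have -> := E0 (P `&` kappa @^-1` [set 1%g]) kappa'.
  by have -> := E0 (P `&` kappa' @^-1` [set 1%g]) (fun s => (kappa s)^-1%g).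
rewrite -(measure_act g^-1%g); last first.
  rewrite -setIA; apply: (mI _ (fun s => (kappa s, kappa' s))
    [set p | p.1 = 1%g /\ i p.2 = j]).
  exact: dmeas_pair.
congr (m _); rewrite image_act invgK; apply/seteqP; split=> s /=.
  move=> [[/invP Ps]]; have Os := PO _ Ps.
  rewrite (retr_equiv rk) // (retr_equiv rk') // -gj => /mulg1_eq <- /ii gk.
  rewrite invgK; split=> //; split=> //.
  by apply: (@mulgI _ g); rewrite gk mulg1.
move=> [[Ps k1]]; have Os := PO _ Ps; rewrite -gj => /ii kg.
split; last by rewrite (retr_equiv rk') // k1 mulg1.
by split; [exact/invP|rewrite (retr_equiv rk) // -kg mulVg].
Qed.

(** Translating the pieces of [D] back into the fundamental domain covers each of its
    points at most [K] times. *)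
Lemma measure_le_multiplicity (kappa : S -> G) (D : set S) (K : nat) :
  retraction a Om kappa -> measurable D -> D `<=` Om ->
  (forall s (r : seq G), uniq r -> (forall x, x \in r -> D (a x s)) -> (size r <= K)%N) ->
  (m D <= K%:R%:E * m (Om `&` kappa @^-1` [set 1%g]))%E.
Proof.
move=> rk mD DO DK; have [i ii] := countable_injection countG.
have dk := retraction_dmeas rk; set X := _ `&` _.
have mX : measurable X by exact: (retr_meas rk).
pose e j := xget 1%g [set g | i g = j].
pose B j := X `&` [set s | i (e j) = j /\ D (a (e j) s)].
have mB j : measurable (B j).
  apply: measurableI => //; have [ej|ne] := pselect (i (e j) = j).
    rewrite (_ : [set _ | _] = a (e j) @^-1` D); first exact: measurable_preimage_act.
    by apply/seteqP; split=> s /=; [case|].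
  by rewrite (_ : [set _ | _] = set0) // -subset0 => s [].
have mBE j : m (D `&` [set s | i (kappa s) = j]) = m (B j).
  have [[g gj]|ne] := fiber_cases i j; last first.
    congr (m _); transitivity (@set0 S); last apply/esym; rewrite -subset0.
      by move=> s [_ /ne].
    by move=> s [_ [/ne]].
  have eg : e j = g.
    by apply: ii; rewrite gj; exact: (@xgetPex _ 1%g [set g | i g = j] (ex_intro _ g gj)).
  rewrite -(measure_act g (mB j)); congr (m _); rewrite image_act.
  apply/seteqP; split=> s /=; rewrite /B eg.
    move=> [Ds]; rewrite -gj => /ii ks; have Os := DO _ Ds; split; last first.
      by split=> //; rewrite actKV.
    by split; [exact/(retr_inv rk)|rewrite /= (retr_equiv rk) // ks mulVg].
  move=> [[/(retr_inv rk) Os]]; rewrite /= (retr_equiv rk) //.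
  move=> /mulg1_eq; rewrite invgK actKV => gk [_ Ds]; split=> //.
  by rewrite -gk.
rewrite (measure_fibers i dk mD DO); apply: lime_le.
  exact: is_cvg_nneseries.
apply: nearW => J; under eq_bigr do rewrite mBE.
rewrite big_mkord.
have -> : (\sum_(j < J) m (B j) = \int[m]_(s in X) \sum_(j < J) (\1_(B j) s)%:E)%E.
  rewrite ge0_integral_sum //; last first.
    move=> j; apply/measurable_EFinP; exact: measurable_indic.
  apply: eq_bigr => j _; rewrite integral_indic // setIidl //.
  by move=> s [].
rewrite -integral_cst //; apply: ge0_le_integral => //.
- by move=> s _; apply: sume_ge0.
- apply: emeasurable_sum => j; apply/measurable_EFinP; exact: measurable_indic.
- move=> s Xs; rewrite sumEFin lee_fin.
  (* The indices of the pieces containing [s] give distinct group elements carrying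
     [s] into [D]. *)
  pose r := [seq j : 'I_J <- index_enum 'I_J | s \in B j].
  have -> : \sum_(j < J) \1_(B j) s = (size r)%:R :> R.
    rewrite /r size_filter -sum1_count natr_sum [RHS]big_mkcond /=.
    by apply: eq_bigr => j _; rewrite indicE; case: (s \in B j).
  rewrite ler_nat -(size_map (fun j : 'I_J => e j)); apply: (DK s).
    rewrite map_inj_in_uniq; first by rewrite filter_uniq // index_enum_uniq.
    move=> j k; rewrite !mem_filter => /andP[/set_mem[_ [ej _]] _].
    move=> /andP[/set_mem[_ [ek _]] _] ejk; apply: val_inj.
    by rewrite /= -ej -ek ejk.
  move=> x /mapP[j]; rewrite mem_filter => /andP[/set_mem[_ [_ Dj]] _] ->.
  exact: Dj.
Qed.
End MassTransport.

(** * Marginals of independent draws *)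

Section ProductFap.
Variable R : realType.

Lemma fap_prod_fst (S T : Type) (mu : fap R S) (nu : fap R T) A :
  fap_prod mu nu (fst @^-1` A) = mu A.
Proof.
rewrite /= -[RHS]mean_indic; congr (mean mu _); apply/funext => s.
rewrite indicE; have [As|As] := pselect (A s).
  rewrite mem_set // -[RHS](fap_setT nu); congr (nu _).
  by apply/seteqP; split.
rewrite memNset // -[RHS](fap_set0 nu); congr (nu _).
by apply/seteqP; split.
Qed.

Lemma fap_prod_snd (S T : Type) (mu : fap R S) (nu : fap R T) A :
  fap_prod mu nu (snd @^-1` A) = nu A.
Proof. by rewrite -[RHS](mean_cst mu). Qed.

(** Also used with [mu' = mu] and [nu' = nu]: if [p] and [q] preserve the factors, then
    their product preserves the product. *)
Lemma fap_prod_map (S S' T T' : Type) (mu : fap R S) (mu' : fap R S') (nu : fap R T)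
    (nu' : fap R T') (p : S -> S') (q : T -> T') A :
  (forall B, mu' B = mu (p @^-1` B)) -> (forall B, nu' B = nu (q @^-1` B)) ->
  fap_prod mu' nu' A = fap_prod mu nu ((fun x => (p x.1, q x.2)) @^-1` A).
Proof.
move=> mup nuq /=; rewrite (mean_pushforward (p := p) mup); last first.
  exact: (@bounded_fap _ _ _ (fun s => fap_map (pair s) nu') A).
by congr (mean mu _); apply/funext => s /=; rewrite nuq.
Qed.

Variables (T : Type) (nu : fap R T).

Definition fap_cube : fap R (T * T * T) := fap_prod (fap_prod nu nu) nu.

Lemma fap_cube12 A :
  fap_prod nu nu A = fap_cube ((fun t => (t.1.1, t.1.2)) @^-1` A).
Proof.
rewrite -[LHS](fap_prod_fst (fap_prod nu nu) nu); congr (fap_cube _).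
by apply/seteqP; split=> -[[x y] z].
Qed.

Lemma fap_cube13 A :
  fap_prod nu nu A = fap_cube ((fun t => (t.1.1, t.2)) @^-1` A).
Proof.
apply: (fap_prod_map (p := fst) (q := id)) => // B.
by rewrite fap_prod_fst.
Qed.

Lemma fap_cube23 A :
  fap_prod nu nu A = fap_cube ((fun t => (t.1.2, t.2)) @^-1` A).
Proof.
apply: (fap_prod_map (p := snd) (q := id)) => // B.
by rewrite fap_prod_snd.
Qed.
End ProductFap.

(** * Random perturbation of the points of H *)

Lemma countable_pair (T U : Type) : countable [set: T] -> countable [set: U] ->
  countable [set: T * U].
Proof.
move=> cT cU; rewrite (_ : [set: T * U] = setT `*` setT); first exact: countableX.
by apply/seteqP; split.
Qed.

Lemma infinite_uniq_seq (T : choiceType) (A : set T) n : infinite_set A ->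
  exists r : seq T, [/\ uniq r, size r = n & forall x, x \in r -> A x].
Proof.
move=> infA; elim: n => [|n [r [ur <- rA]]]; first by exists [::].
have [x [Ax xr]] : exists x, A x /\ x \notin r.
  apply: contrapT => ne; apply: infA; apply: (@sub_finite_set _ _ [set` r]).
    move=> x Ax /=; apply: contrapT => /negP xr; apply: ne; by exists x.
  exact: finite_seq.
exists (x :: r); split=> //=; first by rewrite xr.
by move=> y; rewrite inE => /orP[/eqP -> //|]; exact: rA.
Qed.

Section Laws.
Variables (R : realType) (G H : groupType) (d : measure_display) (S : measurableType d).
Variables (m : {measure set S -> \bar R}) (a : mp_action G m) (b : mp_action H m).
Variables (Om : set S) (kappa : S -> G) (chi : S -> H).
Hypotheses (countG : countable [set: G]) (countH : countable [set: H]).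
Hypothesis comm : forall g h s, a g (b h s) = b h (a g s).
Hypotheses (rk : retraction a Om kappa) (rc : retraction b Om chi).

Let Y := Om `&` kappa @^-1` [set 1%g].
Let X := Om `&` chi @^-1` [set 1%g].
Hypothesis Y_neq0 : m Y != 0%E.

Let OmaE g s : Om (a g s) <-> Om s. Proof. exact: (retr_inv rk). Qed.
Let OmbE h s : Om (b h s) <-> Om s. Proof. exact: (retr_inv rc). Qed.
Let mY : measurable Y. Proof. exact: (retr_meas rk). Qed.
Let dk : discretely_measurable Om kappa. Proof. exact: (retraction_dmeas countG rk). Qed.
Let dc : discretely_measurable Om chi. Proof. exact: (retraction_dmeas countH rc). Qed.

Definition vol (A : set S) : R := fine (m A).

Lemma fin_subY A : measurable A -> A `<=` Y -> m A \is a fin_num.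
Proof.
move=> mA AY; rewrite ge0_fin_numE //.
by apply: le_lt_trans (retr_fin rk); apply: le_measure; rewrite ?inE.
Qed.

Lemma vol_ge0 A : 0 <= vol A. Proof. by rewrite fine_ge0. Qed.

Lemma vol_gt0 : 0 < vol Y.
Proof. by rewrite lt_def vol_ge0 fine_eq0 ?Y_neq0 // fin_subY. Qed.

Lemma volU A B : measurable A -> measurable B -> m A \is a fin_num -> m B \is a fin_num ->
  A `&` B = set0 -> vol (A `|` B) = vol A + vol B.
Proof. by move=> mA mB fA fB AB; rewrite /vol measureU // fineD. Qed.

Lemma le_vol A B : measurable A -> measurable B -> m B \is a fin_num ->
  A `<=` B -> vol A <= vol B.
Proof.
move=> mA mB fB AB; have lAB : (m A <= m B)%E by apply: le_measure; rewrite ?inE.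
apply: fine_le => //; rewrite ge0_fin_numE //; apply: (le_lt_trans lAB).
by rewrite -ge0_fin_numE.
Qed.

Lemma measurable_Y_preimage (T : Type) (v : S -> T) A : discretely_measurable Om v ->
  measurable (Y `&` v @^-1` A).
Proof.
move=> mv; rewrite (_ : Y `&` _ = Y `&` (Om `&` v @^-1` A)); last first.
  by rewrite setIA (setIidl (B := Om)) // => s [].
by apply: measurableI => //; exact: mv.
Qed.

Section Law.
Variables (T : Type) (v : S -> T) (mv : discretely_measurable Om v).

Let law_fun A := vol (Y `&` v @^-1` A) / vol Y.

Let law_ge0 A : 0 <= law_fun A.
Proof. by rewrite divr_ge0 ?vol_ge0. Qed.

Let law_setT : law_fun setT = 1.
Proof. by rewrite /law_fun preimage_setT setIT divff // gt_eqF ?vol_gt0. Qed.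

Let law_setU A B : A `&` B = set0 -> law_fun (A `|` B) = law_fun A + law_fun B.
Proof.
move=> AB; rewrite /law_fun -mulrDl; congr (_ / _).
rewrite preimage_setU setIUr volU //; try exact: measurable_Y_preimage.
- by apply: fin_subY => [|s []//]; exact: measurable_Y_preimage.
- by apply: fin_subY => [|s []//]; exact: measurable_Y_preimage.
- by rewrite setIACA -preimage_setI AB preimage_set0 setI0.
Qed.

Definition fap_law : fap R T := Fap law_ge0 law_setT law_setU.
End Law.

(** The point h^-1 s is brought back to the fundamental domain [Y] of [G], moved by n^-1,
    and read in [H] through [chi]. Bringing it back makes the result [G]-invariant in [s];
    the conjugation by [h] makes it [H]-equivariant in [(h, s)]. *)
Definition perturb (n : G) (h : H) (s : S) : H :=
  (h * chi (a (n^-1 * (kappa (b h^-1 s))^-1) (b h^-1 s)))%g.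

Lemma dmeas_act (T : Type) (v : S -> T) g :
  discretely_measurable Om v -> discretely_measurable Om (fun s => v (a g s)).
Proof. by move=> mv; apply: (dmeas_comp (f := a g)) => //; exact: act_measurable. Qed.

Lemma dmeas_actb (T : Type) (v : S -> T) h :
  discretely_measurable Om v -> discretely_measurable Om (fun s => v (b h s)).
Proof. by move=> mv; apply: (dmeas_comp (f := b h)) => //; exact: act_measurable. Qed.

Lemma perturb_dmeas n h : discretely_measurable Om (perturb n h).
Proof.
apply: (@dmeas_bind _ _ _ _ _ (fun s => kappa (b h^-1%g s))
  (fun g s => (h * chi (a (n^-1 * g^-1) (b h^-1 s)))%g)) => //.
  exact: dmeas_actb.
move=> g; apply: (dmeas_map (fun x => h * x)%g).
by apply: (dmeas_actb (v := fun s => chi (a _ s))); exact: dmeas_act.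
Qed.

Lemma perturb_act n h g s : Om s -> perturb n h (a g s) = perturb n h s.
Proof.
move=> Os; rewrite /perturb -comm (retr_equiv rk); last exact/OmbE.
by rewrite -actM invgM mulgA mulgVK.
Qed.

Lemma perturb_translate n x h s : perturb n (x * h)%g s = (x * perturb n h (b x^-1%g s))%g.
Proof. by rewrite /perturb invgM !actM mulgA. Qed.

(** On the set where h^-1 s lies in a given translate of [Y], the perturbed point is
    the value of [chi] at a fixed translate of [s]. *)
Lemma perturb_piece n h g s : Om s -> kappa (b h^-1%g s) = g ->
  perturb n h s = chi (a (n^-1 * g^-1)%g s).
Proof.
move=> Os kg; rewrite /perturb kg comm (retr_equiv rc) ?mulVKg //.
exact/OmaE.
Qed.

Lemma retraction_translate x : retraction a Om (fun s => kappa (b x s)).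
Proof.
split.
- exact: (retr_inv rk).
- by move=> g s Os; rewrite -comm (retr_equiv rk) //; exact/OmbE.
- by move=> g; exact: (dmeas_actb x dk [set g]).
- apply: le_lt_trans (retr_fin rk); rewrite -[in leRHS](act_preserving b x) //.
  apply: le_measure; rewrite ?inE //; first exact: (dmeas_actb x dk [set 1%g]).
    exact: measurable_preimage_act.
  by move=> s [Os /= ks]; split=> //; exact/OmbE.
Qed.

(** A [G]-invariant variable lives on the quotient of [S] by [G], where [H] still acts
    and preserves the measure; integration over [Y] is integration over that quotient. *)
Lemma vol_translate (T : Type) (v : S -> T) x A : discretely_measurable Om v ->
  (forall g s, Om s -> v (a g s) = v s) ->
  vol (Y `&` (fun s => v (b x^-1%g s)) @^-1` A) = vol (Y `&` v @^-1` A).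
Proof.
move=> mv inv; congr fine; rewrite -(act_preserving b x); last first.
  by apply: measurable_Y_preimage; exact: (dmeas_actb _ mv).
pose P := Om `&` v @^-1` A.
have invP g s : P (a g s) <-> P s.
  split=> -[Os As].
    have {}Os : Om s by move/OmaE : Os.
    by split=> //; move: As; rewrite /= inv.
  by split; [exact/OmaE|rewrite /= inv].
have E := measure_invariant_domain countG rk (retraction_translate x) (mv A)
  (@subIsetl _ Om _) invP.
have -> : Y `&` v @^-1` A = P `&` kappa @^-1` [set 1%g] by rewrite /Y setIAC.
rewrite E; congr (m _); apply/seteqP; split=> s /=.
  move=> [[/OmbE Os ks] /=]; rewrite actK => As; by [].
move=> [[Os As] ks]; split; first by split=> //; exact/OmbE.
by rewrite /= actK.
Qed.

Let countHH : countable [set: H * H]. Proof. exact: countable_pair. Qed.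

Lemma perturb2_dmeas h0 h1 (n : G * G) :
  discretely_measurable Om (fun s => (perturb n.1 h0 s, perturb n.2 h1 s)).
Proof. by apply: dmeas_pair => //; exact: perturb_dmeas. Qed.

Lemma perturb3_dmeas h0 h1 h2 (n : G * G * G) :
  discretely_measurable Om
    (fun s => (perturb n.1.1 h0 s, perturb n.1.2 h1 s, perturb n.2 h2 s)).
Proof.
exact: (dmeas_pair countHH (perturb2_dmeas h0 h1 n.1) (perturb_dmeas n.2 h2)).
Qed.

Definition law2 (h0 h1 : H) (n : G * G) : fap R (H * H) :=
  fap_law (perturb2_dmeas h0 h1 n).

Definition law3 (h0 h1 h2 : H) (n : G * G * G) : fap R (H * H * H) :=
  fap_law (perturb3_dmeas h0 h1 h2 n).

Variable nu : fap R G.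

Definition mean_law2 h0 h1 : fap R (H * H) := fap_bind (fap_prod nu nu) (law2 h0 h1).

Definition mean_law3 h0 h1 h2 : fap R (H * H * H) :=
  fap_bind (fap_cube nu) (law3 h0 h1 h2).

Lemma mean_law12 h0 h1 h2 A :
  mean_law2 h0 h1 A = mean_law3 h0 h1 h2 ((fun t => (t.1.1, t.1.2)) @^-1` A).
Proof.
rewrite [LHS](mean_pushforward (fap_cube12 nu)) //.
exact: (bounded_fap (law2 h0 h1)).
Qed.

Lemma mean_law13 h0 h1 h2 A :
  mean_law2 h0 h2 A = mean_law3 h0 h1 h2 ((fun t => (t.1.1, t.2)) @^-1` A).
Proof.
rewrite [LHS](mean_pushforward (fap_cube13 nu)) //.
exact: (bounded_fap (law2 h0 h2)).
Qed.

Lemma mean_law23 h0 h1 h2 A :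
  mean_law2 h1 h2 A = mean_law3 h0 h1 h2 ((fun t => (t.1.2, t.2)) @^-1` A).
Proof.
rewrite [LHS](mean_pushforward (fap_cube23 nu)) //.
exact: (bounded_fap (law2 h1 h2)).
Qed.

(** The perturbation is [H]-equivariant and the measure on the quotient by [G] is
    [H]-invariant, so the averaged laws are equivariant. *)
Lemma mean_law2_translate x h0 h1 A :
  mean_law2 (x * h0)%g (x * h1)%g A =
  mean_law2 h0 h1 ((fun t => (x * t.1, x * t.2)%g) @^-1` A).
Proof.
congr (mean _ _); apply/funext => n; congr (_ / _).
pose w s := ((x * perturb n.1 h0 s)%g, (x * perturb n.2 h1 s)%g).
rewrite -[RHS](@vol_translate _ w x).
- congr (vol (_ `&` _)); apply/seteqP; split=> s /=; by rewrite !perturb_translate.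
- by apply: dmeas_pair => //; apply: (dmeas_map (fun y => x * y)%g); exact: perturb_dmeas.
- by move=> g s Os; rewrite /w !perturb_act.
Qed.

Variables (E : set (H * H * H)) (K : nat).
Hypothesis multE : forall (t : H * H * H) (r : seq H), uniq r ->
  (forall x, x \in r -> E (x * t.1.1, x * t.1.2, x * t.2)%g) -> (size r <= K)%N.

(** The triple of perturbed points on the piece of [Y] indexed by [g], by
    [perturb_piece], extended to all of [S] by the same formula. Unlike [perturb] it is
    [H]-equivariant in [s] alone, since [g] is fixed. *)
Definition drift (n g : G * G * G) (s : S) : H * H * H :=
  (chi (a (n.1.1^-1 * g.1.1^-1) s), chi (a (n.1.2^-1 * g.1.2^-1) s),
   chi (a (n.2^-1 * g.2^-1) s))%g.

Definition drift_set n g := Om `&` drift n g @^-1` E.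

Lemma drift_dmeas n g : discretely_measurable Om (drift n g).
Proof.
exact: (dmeas_pair countHH (dmeas_pair countH (dmeas_act _ dc) (dmeas_act _ dc))
  (dmeas_act _ dc)).
Qed.

Let C := K%:R * vol X.

(** By equivariance of [drift], each [H]-orbit meets [drift_set] as often as a diagonal
    orbit meets [E], at most [K] times. *)
Lemma measure_drift_set n g : (m (drift_set n g) <= C%:E)%E.
Proof.
have finX : m X \is a fin_num by rewrite ge0_fin_numE // (retr_fin rc).
rewrite EFinM /vol fineK //; apply: (measure_le_multiplicity countH rc).
- exact: drift_dmeas.
- exact: subIsetl.
move=> s r ur rE; have [Os|nOs] := pselect (Om s); last first.
  case: r ur rE => [//|x r] _ /(_ x); rewrite mem_head => /(_ isT)[].
  by move=> /OmbE.
apply: (multE (t := drift n g s) ur) => x /rE[_]; rewrite /drift /=.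
by rewrite !comm !(retr_equiv rc) //; exact/OmaE.
Qed.

Lemma fin_drift_set A n g : measurable A -> A `<=` drift_set n g -> m A \is a fin_num.
Proof.
move=> mA AD; rewrite ge0_fin_numE //; apply: (@le_lt_trans _ _ C%:E); last exact: ltry.
apply: le_trans (measure_drift_set n g); apply: le_measure; rewrite ?inE //.
exact: drift_dmeas.
Qed.

Lemma measurable_drift_fiber n g (A : set G) : measurable (drift_set n g `&` kappa @^-1` A).
Proof.
rewrite /drift_set -setIA [_ `&` kappa @^-1` _]setIC setIA.
rewrite (_ : _ `&` _ = (Om `&` kappa @^-1` A) `&` (Om `&` drift n g @^-1` E)).
  by apply: measurableI; [exact: dk|exact: drift_dmeas].
by apply/seteqP; split=> s /=; tauto.
Qed.

Lemma vol_drift_fibers n g (r : seq G) : uniq r ->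
  \sum_(l <- r) vol (drift_set n g `&` kappa @^-1` [set l]) <=
  vol (drift_set n g `&` kappa @^-1` [set` r]).
Proof.
elim: r => [|l r IH] /=; first by rewrite big_nil vol_ge0.
move=> /andP[lr ur]; rewrite big_cons.
apply: (@le_trans _ _ (vol (drift_set n g `&` kappa @^-1` [set l]) +
  vol (drift_set n g `&` kappa @^-1` [set` r]))); first by rewrite lerD2l IH.
have mf A := measurable_drift_fiber n g A.
have ff A : m (drift_set n g `&` kappa @^-1` A) \is a fin_num.
  by apply: (@fin_drift_set _ n g) => //; exact: subIsetl.
rewrite -volU //; last first.
  by rewrite -subset0 => s [[_ /= ->] [_ /=]]; rewrite (negbTE lr).
apply: le_vol => //; first exact: measurableU.
by move=> s [] [Ds /= ks]; split=> //=; rewrite inE ?ks ?eqxx ?orbT.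
Qed.

Variable N : set G.
Hypotheses (N_inf : infinite_set N) (N_inv : forall l, N l -> N l^-1%g)
  (N_conj : forall l g, N l -> N (g^-1 * l * g)%g).
Hypothesis nu_inv : forall l A, N l -> nu A = nu ((fun x => l * x)%g @^-1` A).

Lemma fap_cube_shift (l : G * G * G) A : N l.1.1 -> N l.1.2 -> N l.2 ->
  fap_cube nu A =
  fap_cube nu ((fun n => (l.1.1 * n.1.1, l.1.2 * n.1.2, l.2 * n.2)%g) @^-1` A).
Proof.
move=> N0 N1 N2; apply: (fap_prod_map (mu := fap_prod nu nu)
  (p := fun x => (l.1.1 * x.1, l.1.2 * x.2)%g) (q := fun x => l.2 * x)%g) => B.
  by apply: fap_prod_map => B'; exact: nu_inv.
exact: nu_inv.
Qed.

Definition drift_vol g l n := vol (drift_set n g `&` kappa @^-1` [set l]).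

Lemma drift_vol_le g l n : 0 <= drift_vol g l n <= C.
Proof.
rewrite vol_ge0 /= -lee_fin /drift_vol /vol fineK; last first.
  apply: (@fin_drift_set _ n g); [exact: measurable_drift_fiber|exact: subIsetl].
apply: le_trans (measure_drift_set n g); apply: le_measure; rewrite ?inE //.
  exact: measurable_drift_fiber.
exact: drift_dmeas.
Qed.

Lemma bounded_drift_vol g l : bounded_fct (drift_vol g l).
Proof. by exists C => n; have /andP[v0 vC] := drift_vol_le g l n; rewrite ger0_norm. Qed.

(** Moving [s] by [l] has the same effect on [drift] as multiplying each n_i on the left
    by g_i^-1 l^-1 g_i, which lies in [N] by normality and leaves the mean unchanged. *)
Lemma mean_drift_vol g l : N l ->
  mean (fap_cube nu) (drift_vol g l) = mean (fap_cube nu) (drift_vol g 1%g).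
Proof.
(* The inverse of [l] appears because [drift] moves [s] by inverses. *)
move=> Nl; pose c x := (x^-1 * l^-1 * x)%g.
have Nc x : N (c x) by apply: N_conj; exact: N_inv.
rewrite [RHS](mean_pushforward (fun A => @fap_cube_shift (c g.1.1, c g.1.2, c g.2) A
  (Nc _) (Nc _) (Nc _))); last exact: bounded_drift_vol.
congr (mean _ _); apply/funext => n; rewrite /drift_vol /= /vol.
rewrite -(act_preserving a l); last exact: measurable_drift_fiber.
congr (fine (m _)); rewrite /drift_set /drift /c /=.
have shift (x y : G) s : a (y^-1 * x^-1)%g (a l s) =
    a ((x^-1 * l^-1 * x * y)^-1 * x^-1)%g s.
  by rewrite -actM; congr (a _ s); rewrite !invgM !invgK !mulgA mulgK.
apply/seteqP; split=> s /=; rewrite !shift.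
  move=> [[/OmaE Os Es] kl]; split=> //; apply: (@mulgI _ l).
  by rewrite mulg1 -(retr_equiv rk).
move=> [[Os Es] k1]; rewrite (retr_equiv rk) // k1 mulg1; split=> //.
by split=> //; exact/OmaE.
Qed.

(** The infinitely many disjoint translates of [Y] by [N] have equal averaged traces on
    a set of measure at most [C]. *)
Lemma mean_drift_vol0 g : mean (fap_cube nu) (drift_vol g 1%g) = 0.
Proof.
set c := mean _ _; apply/eqP; rewrite eq_le andbC; apply/andP; split.
  apply: mean_ge0 => [|n]; first exact: bounded_drift_vol.
  by have /andP[] := drift_vol_le g 1%g n.
rewrite leNgt; apply/negP => c0.
(* More than C / c translates of equal trace [c] would exceed the total [C]. *)
have [r [ur sr rN]] := infinite_uniq_seq (Num.truncn (C / c)).+1 N_inf.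
have : (size r)%:R * c <= C.
  have -> : (size r)%:R * c = \sum_(l <- r) mean (fap_cube nu) (drift_vol g l).
    rewrite (eq_big_seq (fun=> c)) => [|l /rN Nl]; last exact: mean_drift_vol.
    by rewrite big_const_seq count_predT iter_addr_0 mulr_natl.
  rewrite -mean_sum; last by move=> l; exact: bounded_drift_vol.
  apply: mean_le_cst => [|n]; first by apply: bounded_fct_sum => l; exact: bounded_drift_vol.
  apply: (le_trans (vol_drift_fibers n g ur)); rewrite -lee_fin /vol fineK; last first.
    apply: (@fin_drift_set _ n g); [exact: measurable_drift_fiber|exact: subIsetl].
  apply: le_trans (measure_drift_set n g); apply: le_measure; rewrite ?inE //.
    exact: measurable_drift_fiber.
  exact: drift_dmeas.
by apply/negP; rewrite -ltNge -ltr_pdivrMr // sr; exact: truncnS_gt.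
Qed.

Let GGG := (G * G * G)%type.
Let countGG : countable [set: G * G]. Proof. exact: countable_pair. Qed.
Let countGGG : countable [set: GGG]. Proof. exact: countable_pair. Qed.

(** The translates of [Y] that contain the three points h_i^-1 s. *)
Definition chamber (h0 h1 h2 : H) (s : S) : GGG :=
  (kappa (b h0^-1 s), kappa (b h1^-1 s), kappa (b h2^-1 s))%g.

Lemma chamber_dmeas h0 h1 h2 : discretely_measurable Om (chamber h0 h1 h2).
Proof.
exact: (dmeas_pair countGG (dmeas_pair countG (dmeas_actb _ dk) (dmeas_actb _ dk))
  (dmeas_actb _ dk)).
Qed.

Let joint_dmeas h0 h1 h2 (n : GGG) :=
  dmeas_pair countGGG (chamber_dmeas h0 h1 h2) (perturb3_dmeas h0 h1 h2 n).

(** Both the chamber and the perturbed triple are recorded, so that finite additivity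
    can be applied to sets of chambers. *)
Definition joint_law h0 h1 h2 (n : GGG) : fap R (GGG * (H * H * H)) :=
  fap_law (joint_dmeas h0 h1 h2 n).

Let joint h0 h1 h2 := fap_bind (fap_cube nu) (joint_law h0 h1 h2).

Lemma joint_chamber0 h0 h1 h2 g : joint h0 h1 h2 ([set g] `*` E) = 0.
Proof.
apply/eqP; rewrite eq_le fap_ge0 andbT.
have <- : (vol Y)^-1 * mean (fap_cube nu) (drift_vol g 1%g) = 0.
  by rewrite mean_drift_vol0 mulr0.
rewrite -meanZ; last exact: bounded_drift_vol.
apply: le_mean.
- exact: (bounded_fap (joint_law h0 h1 h2)).
- exact/bounded_fctZ/bounded_drift_vol.
move=> n /=; rewrite mulrC ler_pM2l ?invr_gt0 ?vol_gt0 //.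
apply: le_vol.
- exact: (measurable_Y_preimage _ (joint_dmeas h0 h1 h2 n)).
- exact: measurable_drift_fiber.
- apply: (@fin_drift_set _ n g); [exact: measurable_drift_fiber|exact: subIsetl].
move=> s [[Os k1] /= [cg Es]]; split=> //; split=> //.
move: Es; rewrite /drift -cg /= (perturb_piece _ (h := h0) Os erefl).
by rewrite (perturb_piece _ (h := h1) Os erefl) (perturb_piece _ (h := h2) Os erefl).
Qed.

(** Each chamber contributes nothing, by [mean_drift_vol0]. Countably many chambers
    cannot be summed under a finitely additive mean; but the chamber does not depend on
    the averaged variable, so outside finitely many chambers the mass is uniformly small
    by countable additivity of the measure of [S]. *)
Lemma mean_law3_orbit_finite0 h0 h1 h2 : mean_law3 h0 h1 h2 E = 0.
Proof.
have [i ii] := countable_injection countGGG.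
have j0 j : joint h0 h1 h2 ([set g | (i g < j)%N] `*` E) = 0.
  elim: j => [|j IH]; first by rewrite (_ : _ `*` _ = set0) ?fap_set0 // -subset0 => -[g t] [].
  rewrite (_ : _ `*` _ = ([set g | (i g < j)%N] `*` E) `|` ([set g | i g = j] `*` E)).
    rewrite fap_setU; last by rewrite -subset0 => -[g t] /= [[+ _] [gj _]]; rewrite gj ltnn.
    rewrite IH add0r; have [[g gj]|ne] := fiber_cases i j.
      rewrite (_ : [set g | i g = j] = [set g]) ?joint_chamber0 //.
      by apply/seteqP; split=> k /=; [rewrite -gj => /ii|move=> ->].
    by rewrite (_ : _ `*` _ = set0) ?fap_set0 // -subset0 => -[g t] [/ne].
  apply/seteqP; split=> -[g t] /=.
    by rewrite ltnS leq_eqVlt => -[/orP[/eqP ?|?] ?]; [right|left].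
  by case=> -[gj Et]; split=> //; [exact: leqW|rewrite gj].
pose F j := Y `&` [set s | (j <= i (chamber h0 h1 h2 s))%N].
have mF j : measurable (F j).
  exact: (measurable_Y_preimage [set g | (j <= i g)%N] (chamber_dmeas h0 h1 h2)).
have Fcvg : vol (F j) @[j --> \oo] --> (0 : R).
  have -> : 0 = fine (m (\bigcap_j F j)) :> R.
    rewrite (_ : \bigcap_j F j = set0) ?measure0 // -subset0 => s.
    move=> /(_ (i (chamber h0 h1 h2 s)).+1 I).
    by case=> _ /=; rewrite ltnn.
  apply: fine_cvg; rewrite fineK; last first.
    by apply: fin_subY; [exact: bigcapT_measurable|move=> s /(_ 0%N I) []].
  apply: nonincreasing_cvg_mu => //.
  - by rewrite -ge0_fin_numE // fin_subY // => s [].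
  - exact: bigcapT_measurable.
  - move=> j k jk; apply/subsetPset => s [Ys /= ks]; split=> //=; exact: leq_trans ks.
apply/eqP; rewrite eq_le fap_ge0 andbT; apply/ler_addgt0Pr => e e0; rewrite add0r.
have /cvgrPdist_lt/(_ (e * vol Y))/(_ _)[|j _ /(_ j (leqnn j))] := Fcvg.
  by rewrite mulr_gt0 // vol_gt0.
rewrite sub0r normrN ger0_norm ?vol_ge0 // -ltr_pdivrMr ?vol_gt0 // => Fe.
have -> : mean_law3 h0 h1 h2 E = joint h0 h1 h2 (snd @^-1` E) by [].
rewrite (_ : snd @^-1` E = ([set g | (i g < j)%N] `*` E) `|` ([set g | (j <= i g)%N] `*` E)).
  rewrite fap_setU; last first.
    by rewrite -subset0 => -[g t] /= [[ig _] [jg _]]; move: ig; rewrite ltnNge jg.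
  rewrite j0 add0r (le_trans _ (ltW Fe)) //; apply: mean_le_cst.
    exact: (bounded_fap (joint_law h0 h1 h2)).
  move=> n /=; rewrite ler_pM2r ?invr_gt0 ?vol_gt0 //; apply: le_vol => //.
  - exact: (measurable_Y_preimage _ (joint_dmeas h0 h1 h2 n)).
  - by rewrite fin_subY // => s [].
  - by move=> s [Ys /= [? _]].
apply/seteqP; split=> -[g t] /=; last by case=> -[].
by move=> Et; have [?|?] := ltnP (i g) j; [left|right].
Qed.
End Laws.

(** * The prism formula *)

Section Primitive.
Variables (R : realType) (H : groupType).

(** Superlevel sets of a function with uniformly bounded square sums along diagonal
    orbits have this property, by Chebyshev's inequality. *)
Definition orbit_finite (E : set (H * H * H)) := exists K : nat,
  forall (t : H * H * H) (r : seq H), uniq r ->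
    (forall x, x \in r -> E (x * t.1.1, x * t.1.2, x * t.2)%g) -> (size r <= K)%N.

Variables (law2 : H -> H -> fap R (H * H)) (law3 : H -> H -> H -> fap R (H * H * H)).
Hypotheses
  (law12 : forall h0 h1 h2 A,
     law2 h0 h1 A = law3 h0 h1 h2 ((fun t => (t.1.1, t.1.2)) @^-1` A))
  (law13 : forall h0 h1 h2 A,
     law2 h0 h2 A = law3 h0 h1 h2 ((fun t => (t.1.1, t.2)) @^-1` A))
  (law23 : forall h0 h1 h2 A,
     law2 h1 h2 A = law3 h0 h1 h2 ((fun t => (t.1.2, t.2)) @^-1` A))
  (law_translate : forall x h0 h1 A,
     law2 (x * h0)%g (x * h1)%g A = law2 h0 h1 ((fun t => (x * t.1, x * t.2)%g) @^-1` A))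
  (law3_orbit_finite : forall h0 h1 h2 E, orbit_finite E -> law3 h0 h1 h2 E = 0).

Variables (f : H -> H -> H -> R) (C : R).
Hypotheses
  (f_sq : forall h0 h1 h2 r, uniq r ->
     \sum_(x <- r) f (x * h0)%g (x * h1)%g (x * h2)%g ^+ 2 <= C)
  (f_cocycle : forall p q r s, f q r s - f p r s + f p q s - f p q r = 0).

Let f_bound p q r : `|f p q r| <= 1 + C.
Proof.
have := @f_sq p q r [:: 1%g] isT; rewrite big_seq1 !mul1g -(real_normK (num_real _)).
by have := sqr_ge0 (`|f p q r| - 1); rewrite sqrrB; have := normr_ge0 (f p q r); lra.
Qed.

Let bf (T : Type) (p q r : T -> H) : bounded_fct (fun t => f (p t) (q t) (r t)).
Proof. by exists (1 + C) => t. Qed.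

(** Up to a uniformly small error, the cocycle lives on an [orbit_finite] set, which is
    null. *)
Lemma mean_cocycle0 h0 h1 h2 : mean (law3 h0 h1 h2) (fun t => f t.1.1 t.1.2 t.2) = 0.
Proof.
set F := fun t => _; have bF : bounded_fct F by exact: bf.
have small e : 0 < e -> mean (law3 h0 h1 h2) (fun t => `|F t|) <= e.
  move=> e0; pose E := [set t | e <= `|F t|].
  have E0 : law3 h0 h1 h2 E = 0.
    (* Chebyshev: each point of [E] on the orbit contributes at least e ^+ 2 to a sum
       bounded by [C]. *)
    apply: law3_orbit_finite; exists (Num.truncn (C / e ^+ 2)) => t r ur rE.
    rewrite truncn_ge_nat; last first.
      rewrite divr_ge0 ?sqr_ge0 // (le_trans _ (@f_sq 1%g 1%g 1%g [::] isT)) //.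
      by rewrite big_nil.
    rewrite ler_pdivlMr ?exprn_gt0 // (le_trans _ (@f_sq t.1.1 t.1.2 t.2 _ ur)) //.
    rewrite mulr_natl -[X in _ *+ X]count_predT -iter_addr_0 -big_const_seq.
    rewrite [X in _ <= X]big_seq [X in X <= _]big_seq; apply: ler_sum => x /rE xE.
    by rewrite -[leRHS](real_normK (num_real _)) ler_pXn2r // ?nnegrE ltW.
  have bE : bounded_fct (\1_E : _ -> R).
    by exists 1 => t; rewrite indicE; case: (_ \in _); rewrite ?normr1 ?normr0 ?ler01.
  rewrite (@le_trans _ _ (mean (law3 h0 h1 h2) (fun t => e + (1 + C) * \1_E t))) //.
    apply: le_mean => [||t].
    - by exists (1 + C) => t; rewrite normr_id; exact: f_bound.
    - by apply: bounded_fctD; [exact: bounded_fct_cst|exact: bounded_fctZ].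
    have C0 : 0 <= 1 + C := le_trans (normr_ge0 _) (f_bound 1%g 1%g 1%g).
    rewrite indicE; have [Et|nEt] := pselect (E t).
      by rewrite mem_set // mulr1 (le_trans (f_bound _ _ _)) // lerDr ltW.
    by rewrite memNset // mulr0 addr0 leNgt; apply/negP => /ltW.
  rewrite meanD ?meanZ ?mean_cst //; [|exact: bounded_fct_cst|exact: bounded_fctZ].
  by rewrite mean_indic E0 mulr0 addr0.
have babs : bounded_fct (fun t => `|F t|).
  by exists (1 + C) => t; rewrite normr_id; exact: f_bound.
apply/eqP; rewrite -normr_eq0 eq_le normr_ge0 andbT; apply/ler_addgt0Pr => e e0.
rewrite add0r ler_norml; apply/andP; split.
  rewrite lerNl -mulN1r -meanZ //; apply: le_trans (small e e0).
  by apply: le_mean => // [|t]; [exact: bounded_fctZ|rewrite mulN1r -normrN ler_norm].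
by apply: le_trans (small e e0); apply: le_mean => // t; exact: ler_norm.
Qed.

(** The prism between the triple of points and its random perturbation, averaged. Only
    the laws of pairs enter, which is why they must be consistent. *)
Definition primitive h0 h1 : R := mean (law2 h0 h1) (fun t => f h0 h1 t.2 - f h0 t.1 t.2).

Let bp h0 h1 : bounded_fct (fun t : H * H => f h0 h1 t.2 - f h0 t.1 t.2).
Proof. by apply: bounded_fctB; exact: bf. Qed.

(** Three instances of the cocycle identity, on the points h0, h1, h2 and their
    perturbations p, q, r, give the homotopy formula; the term f p q r that remains has
    mean zero. *)
Lemma primitive_coboundary h0 h1 h2 :
  f h0 h1 h2 = primitive h1 h2 - primitive h0 h2 + primitive h0 h1.
Proof.
rewrite /primitive (mean_pushforward (law12 h0 h1 h2) (bp h0 h1)).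
rewrite (mean_pushforward (law13 h0 h1 h2) (bp h0 h2)).
rewrite (mean_pushforward (law23 h0 h1 h2) (bp h1 h2)).
have bpo (p : H * H * H -> H * H) x y : bounded_fct ((fun t => f x y t.2 - f x t.1 t.2) \o p).
  by have [M hM] := bp x y; exists M => t; exact: hM.
rewrite -meanB // -meanD //; last exact: bounded_fctB.
rewrite -[LHS]subr0 -(mean_cocycle0 h0 h1 h2) -[X in X - _](mean_cst (law3 h0 h1 h2)).
rewrite -meanB; [|exact: bounded_fct_cst|exact: bf].
congr (mean _ _); apply/funext => -[[p q] r] /=.
have c1 := f_cocycle h0 h1 q r; have c2 := f_cocycle h0 p q r.
by have c3 := f_cocycle h0 h1 h2 r; lra.
Qed.

(** Equivariance of the laws moves the factor [x] inside the mean, after which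
    [mean_sumsq_le] reduces the bound to one for each fixed value of the perturbation. *)
Lemma primitive_sq h0 h1 r : uniq r ->
  \sum_(x <- r) primitive (x * h0)%g (x * h1)%g ^+ 2 <= 4 * C.
Proof.
move=> ur; pose F x (t : H * H) :=
  f (x * h0)%g (x * h1)%g (x * t.2)%g - f (x * h0)%g (x * t.1)%g (x * t.2)%g.
have bF x : bounded_fct (F x) by apply: bounded_fctB; exact: bf.
rewrite (eq_bigr (fun x => mean (law2 h0 h1) (F x) ^+ 2)) => [|x _].
  apply: mean_sumsq_le => // t.
  have le1 := @f_sq h0 h1 t.2 _ ur; have le2 := @f_sq h0 t.1 t.2 _ ur.
  rewrite (@le_trans _ _ (\sum_(x <- r) (2 * f (x * h0)%g (x * h1)%g (x * t.2)%g ^+ 2 +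
    2 * f (x * h0)%g (x * t.1)%g (x * t.2)%g ^+ 2))) //.
    apply: ler_sum => x _; rewrite /F; set u := f _ _ _; set v := f _ _ _.
    by rewrite sqrrB; have := sqr_ge0 (u + v); rewrite sqrrD; lra.
  by rewrite big_split /= -!mulr_sumr; lra.
by rewrite /primitive (mean_pushforward (law_translate x h0 h1) (bp _ _)).
Qed.
End Primitive.

(** * Cochains with values in the regular representation *)

Lemma quot_full0 (V : zmodType) (I : zmodClosed V) (x : Quotient.quot I) :
  (forall v, v \in I) -> x = 0.
Proof.
move=> fullI; rewrite -[x]reprK; have := fullI (repr x - 0).
by rewrite Quotient.idealrBE => /eqP ->; rewrite raddf0.
Qed.

Section SquareSums.
Variables (R : realType) (G : choiceType).
Implicit Types (u : G -> R[i]) (r : seq G).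

Lemma cabs_sqr (z : R[i]) : cabs z ^+ 2 = complex.Re z ^+ 2 + complex.Im z ^+ 2.
Proof. by case: z => x y; rewrite /cabs normc_def /= sqr_sqrtr // addr_ge0 ?sqr_ge0. Qed.

Lemma sqsum_le u (C : R) :
  (forall r, uniq r -> \sum_(x <- r) cabs (u x) ^+ 2 <= C) -> (sqsum u <= C%:E)%E.
Proof.
move=> uC; apply: ge_ereal_sup => _ [A [finA _] <-].
rewrite fsbig_finite // sumEFin lee_fin; apply: uC; exact: finmap.fset_uniq.
Qed.

Lemma sqsum_ge u r : uniq r -> ((\sum_(x <- r) cabs (u x) ^+ 2)%:E <= sqsum u)%E.
Proof.
move=> ur; apply: esum_ge; exists [set` r]; first by split=> //; exact: finite_seq.
by rewrite -fsbig_seq // sumEFin.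
Qed.

Lemma sqsum_l2_le (u : l2 R G) r : uniq r ->
  \sum_(x <- r) cabs (u x) ^+ 2 <= l2norm u ^+ 2.
Proof. by move=> /(sqsum_ge u); rewrite sqsumE lee_fin. Qed.
End SquareSums.

Section Cochains.
Variables (R : realType) (H : groupType).
Local Notation rho := (regular_rep R H).

Definition triple (h0 h1 h2 : H) (i : 'I_3) : H := nth h0 [:: h0; h1; h2] i.

Lemma norm_l2E (u : l2 R H) : `|u| = (l2norm u)%:C%C.
Proof. by []. Qed.

Lemma triple_translate x h0 h1 h2 :
  triple (x * h0)%g (x * h1)%g (x * h2)%g = fun i => (x * triple h0 h1 h2 i)%g.
Proof. by apply/funext => -[[|[|[|]]]]. Qed.

(** By invariance a cochain is determined by its values at 1, and its other values are
    values at 1 along the diagonal orbit. *)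
Lemma cochain_eval1 n (z : cochain rho n) (t : 'I_n.+1 -> H) x :
  z (fun i => (x * t i)%g) 1%g = z t x^-1%g.
Proof.
have [_ zI] := asboolW (valP z); rewrite -(zI x (fun i => (x * t i)%g)) /= /ltrans mulg1.
by congr (z _ _); apply/funext => i; rewrite mulKg.
Qed.

Lemma cocycle_sq_le (z : cocycle rho 2) : exists C : R, forall h0 h1 h2 r, uniq r ->
  \sum_(x <- r) cabs (z (triple (x * h0) (x * h1) (x * h2))%g 1%g) ^+ 2 <= C.
Proof.
have [[M zM] zI] := asboolW (valP (cocycle_cochain z)).
exists (complex.Re M ^+ 2) => h0 h1 h2 r ur.
under eq_bigr do rewrite triple_translate cochain_eval1.
rewrite -(big_map (fun x => x^-1)%g xpredT (fun y => cabs (z (triple h0 h1 h2) y) ^+ 2)).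
apply: le_trans (sqsum_l2_le _ _) _; first by rewrite map_inj_uniq //; exact: invg_inj.
have := zM (triple h0 h1 h2); rewrite norm_l2E lecE /= => /andP[_ le].
by rewrite ler_pXn2r // nnegrE ?sqrtr_ge0 // (le_trans (sqrtr_ge0 _) le).
Qed.

Lemma triple_lift (x : 'I_4 -> H) (i : 'I_4) : (fun j => x (lift i j)) =
  triple (x (lift i ord0)) (x (lift i 1)) (x (lift i 2)).
Proof.
by apply/funext => -[[|[|[|]]]] // p; rewrite /triple /=; congr (x (lift _ _)); apply: val_inj.
Qed.

Lemma l2_add (u v : l2 R H) y : (u + v) y = u y + v y.
Proof. by []. Qed.

Lemma l2_scale c (u : l2 R H) y : (c *: u) y = c * u y.
Proof. by []. Qed.

Definition quadruple (p q r s : H) (i : 'I_4) : H := nth p [:: p; q; r; s] i.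

Lemma cocycle_identity (z : cocycle rho 2) p q r s y :
  z (triple q r s) y - z (triple p r s) y + z (triple p q s) y - z (triple p q r) y = 0.
Proof.
have /eqP/(congr1 (fun f : cochain rho 3 => f (quadruple p q r s) y)) := valP z.
rewrite /= /coboundary_fun !big_ord_recl big_ord0 !triple_lift.
rewrite !l2_add !l2_scale /= /quadruple /= => E; apply: etrans E.
rewrite -[LHS]addr0 -!addrA expr0 mul1r; congr (_ + (_ + (_ + (_ + _)))).
- by rewrite expr1 mulN1r.
- by rewrite sqrrN expr1n mul1r.
- by rewrite exprS sqrrN expr1n mulr1 mulN1r.
Qed.

Definition bounded_cocycle2 (f : H -> H -> H -> R) := (exists C : R,
    forall h0 h1 h2 r, uniq r ->
      \sum_(x <- r) f (x * h0)%g (x * h1)%g (x * h2)%g ^+ 2 <= C) /\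
  forall p q r s, f q r s - f p r s + f p q s - f p q r = 0.

Definition bounded_cochain1 (c : H -> H -> R) := exists C : R,
  forall h0 h1 r, uniq r -> \sum_(x <- r) c (x * h0)%g (x * h1)%g ^+ 2 <= C.

Lemma cocycle_coordinates (z : cocycle rho 2) (p : {additive R[i] -> R}) :
  (forall w, p w ^+ 2 <= cabs w ^+ 2) ->
  bounded_cocycle2 (fun h0 h1 h2 => p (z (triple h0 h1 h2) 1%g)).
Proof.
move=> pw; split; last first.
  by move=> *; rewrite -!(raddfB, raddfD) /= cocycle_identity raddf0.
have [C zC] := cocycle_sq_le z; exists C => h0 h1 h2 r ur.
by apply: le_trans (zC h0 h1 h2 r ur); apply: ler_sum.
Qed.

Section Assemble.
Variables c c' : H -> H -> R.
Hypotheses (bc : bounded_cochain1 c) (bc' : bounded_cochain1 c').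

(** The inverse of evaluation at 1, for cochains with real part [c] and imaginary
    part [c']. *)
Definition assemble_fun (t : 'I_2 -> H) (y : H) : R[i] :=
  (c (y^-1 * t ord0)%g (y^-1 * t ord_max)%g +i* c' (y^-1 * t ord0)%g (y^-1 * t ord_max)%g)%C.

Lemma assemble_sqsum : exists C : R, forall t, (sqsum (assemble_fun t) <= C%:E)%E.
Proof.
have [C cC] := bc; have [C' cC'] := bc'; exists (C + C') => t.
apply: sqsum_le => r ur; have ur' : uniq [seq x^-1%g | x <- r].
  by rewrite map_inj_uniq //; exact: invg_inj.
under eq_bigr do rewrite cabs_sqr /assemble_fun /=.
rewrite big_split /= lerD //.
  by have := cC (t ord0) (t ord_max) _ ur'; rewrite big_map.
by have := cC' (t ord0) (t ord_max) _ ur'; rewrite big_map.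
Qed.

Lemma assemble_l2 t : assemble_fun t \in @l2_pred R H.
Proof.
have [C hC] := assemble_sqsum; rewrite unfold_in; apply: le_lt_trans (hC t) _.
exact: ltry.
Qed.

Definition assemble_l2fun t : l2 R H := L2 (assemble_l2 t).

Lemma assemble_cochain : assemble_l2fun \in @cochain_pred _ _ _ rho 1.
Proof.
apply/asboolP; split.
  have [C hC] := assemble_sqsum; exists (Num.sqrt C)%:C%C => t.
  rewrite norm_l2E lecR; apply: ler_wsqrtr; rewrite -lee_fin -sqsum_fin; exact: hC.
move=> g t; apply: val_inj; apply/funext => y /=; rewrite /ltrans /assemble_fun.
by rewrite invgM invgK -!mulgA !mulVKg.
Qed.

Definition assemble : cochain rho 1 := Cochain assemble_cochain.
End Assemble.

Hypothesis primitives : forall f, bounded_cocycle2 f -> exists2 c, bounded_cochain1 c &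
  forall h0 h1 h2, f h0 h1 h2 = c h1 h2 - c h0 h2 + c h0 h1.

Lemma cocycle_exact (z : cocycle rho 2) : z \in @exact_pred _ _ _ rho 2.
Proof.
have [|c bc cE] := primitives (@cocycle_coordinates z (@complex.Re R) _).
  by move=> w; rewrite cabs_sqr lerDl sqr_ge0.
have [|c' bc' cE'] := primitives (@cocycle_coordinates z (@complex.Im R) _).
  by move=> w; rewrite cabs_sqr lerDr sqr_ge0.
apply/asboolP; exists (assemble bc bc'); apply: val_inj; apply/funext => t.
apply: val_inj; apply/funext => y.
have tE : t = triple (t ord0) (t 1) (t 2).
  by apply/funext => -[[|[|[|]]]] // p; rewrite /triple /=; congr t; apply: val_inj.
have -> : \val (z t) y = z (fun i => (y^-1 * t i)%g) 1%g.
  by rewrite cochain_eval1 invgK.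
rewrite tE -triple_translate; set w := z _ _.
have -> : w = (complex.Re w +i* complex.Im w)%C by case: w.
rewrite cE cE' /= /coboundary_fun !big_ord_recl big_ord0.
rewrite !l2_add !l2_scale expr0 expr1 mul1r mulN1r sqrrN expr1n mul1r addr0.
rewrite /= /assemble_fun /triple /=.
by apply/eqP; rewrite eq_complex /=; apply/andP; split; apply/eqP; ring.
Qed.

Lemma bounded_cohomology2_eq0 (x : bounded_cohomology rho 2) : x = 0.
Proof. by apply: quot_full0 => z; exact: cocycle_exact. Qed.
End Cochains.

(** * Conclusion *)

Section AmenableFap.
Variables (R : realType) (G : groupType) (N : {pred G}).
Hypotheses (N_normal : normal_subgroup N) (N_amen : amenable_subgroup R N).

(** The measure lives on [N] but is extended to [G], so that the averaged variable can
    range over [G]. *)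
Lemma amenable_fap : exists nu : fap R G, forall l A, l \in N ->
  nu A = nu ((fun x => l * x)%g @^-1` A).
Proof.
have [mu [mu_ge0 mu1 muU muJ]] := N_amen; have [gN _] := N_normal.
pose nu A := mu (A `&` [set` N]).
have nu0 A : 0 <= nu A by exact: mu_ge0.
have nuT : nu setT = 1 by rewrite /nu setTI.
have nuU A B : A `&` B = set0 -> nu (A `|` B) = nu A + nu B.
  move=> AB; rewrite /nu setIUl muU //.
  by rewrite setIACA AB set0I.
exists (Fap nu0 nuT nuU) => l A lN /=.
rewrite /nu -[RHS](muJ l) //; congr mu; apply/seteqP; split=> x /=.
  move=> [Ax xN]; exists (l^-1 * x)%g; last by rewrite mulVKg.
  split; first by rewrite mulVKg.
  by rewrite (group_closedM gN) ?(group_closedV gN).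
by move=> [y [Ay yN] <-]; split=> //; rewrite (group_closedM gN).
Qed.
End AmenableFap.

(** Otherwise all the translates of the domain, which cover a conull set, would be
    null. *)
Lemma conull_domain_neq0 (R : realType) (G : groupType) (d : measure_display)
    (S : measurableType d) (m : {measure set S -> \bar R}) (a : mp_action G m)
    (Om : set S) (kappa : S -> G) :
  countable [set: G] -> measurable Om -> m (~` Om) = 0%E -> m setT != 0%E ->
  retraction a Om kappa -> m (Om `&` kappa @^-1` [set 1%g]) != 0%E.
Proof.
move=> cG mOm nOm mT rk; apply: contra_neq mT => Y0.
have mf g : measurable (Om `&` kappa @^-1` [set g]) by exact: (retr_meas rk).
have f0 g : m (Om `&` kappa @^-1` [set g]) = 0%E.
  rewrite -(act_preserving a g) // -[RHS]Y0; congr (m _); apply/seteqP; split=> s /=.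
    move=> [/(retr_inv rk) Os]; rewrite /= (retr_equiv rk) // => kg; split=> //.
    by apply: (@mulgI _ g); rewrite mulg1.
  move=> [Os k1]; split; first exact/(retr_inv rk).
  by rewrite /= (retr_equiv rk) // k1 mulg1.
rewrite -(setUv Om) measureU0 //; last exact: measurableC.
rewrite (_ : Om = \bigcup_g (Om `&` kappa @^-1` [set g])).
  exact: null_countable_bigcup.
by apply/seteqP; split=> s; [exists (kappa s)|case=> g _ []].
Qed.

Theorem corollary1p19 (R : realType) (G H : groupType) (N : {pred G}) :
  countable [set: G] ->
  normal_subgroup N -> infinite_set [set` N] -> amenable_subgroup R N ->
  in_Creg R H ->
  ~ measure_equivalent R G H.
Proof.
move=> cG nN infN amN [cH [x /eqP x0]] [d [S [m [a [b [_ _ mT comm]]]]]].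
move=> [[E fE finE] [F fF finF]]; apply: x0.
have [nu nu_inv] := amenable_fap nN amN; have [gN cN] := nN.
have [Om [kappa [chi [mOm nOm rk rc]]]] := coupling_retractions cG cH comm fE finE fF finF.
have Y0 := conull_domain_neq0 cG mOm nOm mT rk.
apply: bounded_cohomology2_eq0 => f [[C fC] f_coc].
pose L2 := mean_law2 cG cH rk rc Y0 nu; pose L3 := mean_law3 cG cH rk rc Y0 nu.
have L3_0 h0 h1 h2 A : orbit_finite A -> L3 h0 h1 h2 A = 0.
  move=> [K AK]; apply: (mean_law3_orbit_finite0 cG cH comm rk rc Y0 AK infN) => //.
  - by move=> l; exact: (group_closedV gN).
  - by move=> l g /(cN g); rewrite /conjg mulgA.
exists (primitive L2 f).
  by exists (4 * C) => h0 h1 r; apply: (primitive_sq _ fC); exact: mean_law2_translate.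
move=> h0 h1 h2; apply: (primitive_coboundary _ _ _ L3_0 fC f_coc).
- exact: mean_law12.
- exact: mean_law13.
- exact: mean_law23.
Qed.
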